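(* Let $y\in M$ be such that $({\rm A}_y^+)$ holds with the fundamental solution $\Gamma=\Gamma_y$ in $T_y$. Let $\Omega\subset T_y$ be a strongly admissible domain (with $y$), $y\notin\partial\Omega$, let $\alpha\in\mathbb{R}$, $\alpha>2-\beta$, $\beta>2$ and $R\ge e\,\sup_{\Omega}\Gamma^{\frac{1}{2-\beta}}$. Let $u\in C^1(\Omega)\cap C(\overline{\Omega})$. Then $$\int_{\Omega}\Gamma^{\frac{\alpha}{2-\beta}}|\nabla_Xu|^2\,d\nu\ge\left(\frac{\beta+\alpha-2}{2}\right)^2\int_{\Omega}\Gamma^{\frac{\alpha-2}{2-\beta}}|\nabla_X\Gamma^{\frac{1}{2-\beta}}|^2|u|^2\,d\nu+\frac{\beta+\alpha-2}{2(\beta-2)}\int_{\partial\Omega}\Gamma^{\frac{\alpha}{2-\beta}-1}|u|^2\langle\widetilde{\nabla}\Gamma,d\nu\rangle,$$ and also $$\int_{\Omega}\Gamma^{\frac{\alpha}{2-\beta}}|\nabla_Xu|^2\,d\nu\ge\left(\frac{\beta+\alpha-2}{2}\right)^2\int_{\Omega}\Gamma^{\frac{\alpha-2}{2-\beta}}|\nabla_X\Gamma^{\frac{1}{2-\beta}}|^2|u|^2\,d\nu+\frac14\int_{\Omega}\Gamma^{\frac{\alpha-2}{2-\beta}}|\nabla_X\Gamma^{\frac{1}{2-\beta}}|^2\left(\ln\frac{R}{\Gamma^{\frac{1}{2-\beta}}}\right)^{-2}|u|^2\,d\nu$$ $$+\frac{1}{2(\beta-2)}\int_{\partial\Omega}\Gamma^{\frac{\alpha}{2-\beta}-1}\left(\ln\frac{R}{\Gamma^{\frac{1}{2-\beta}}}\right)^{-1}|u|^2\langle\widetilde{\nabla}\Gamma,d\nu\rangle+\frac{\beta+\alpha-2}{2(\beta-2)}\int_{\partial\Omega}\Gamma^{\frac{\alpha}{2-\beta}-1}|u|^2\langle\widetilde{\nabla}\Gamma,d\nu\rangle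 .$$
   Context: Let $M$ be a smooth manifold of dimension $n$ with a volume form $d\nu$, let $\{X_k\}_{k=1}^{N}$, $N\le n$, be a family of real vector fields on $M$, and let $\mathcal{L}=\sum_{k=1}^{N}X_k^2$, $\nabla_X=(X_1,\ldots,X_N)$. The spaces $C^{1}$, $C^{2}$ are the spaces of functions with continuous first (respectively, up to second) derivatives with respect to $\{X_k\}$. $\langle X_k,d\nu\rangle$ denotes the duality product (contraction) of the vector field $X_k$ with the $n$-form $d\nu$; it is an $(n-1)$-form. For a function $u$, $\widetilde{\nabla}u=\sum_{k=1}^{N}(X_ku)X_k$, so that $\langle\widetilde{\nabla}u,d\nu\rangle=\sum_{k=1}^N (X_ku)\langle X_k,d\nu\rangle$. Assumption $({\rm A}_y)$ for a point $y\in M$: there is an open set $T_y\subset M$ containing $y$ such that $-\mathcal{L}$ has a fundamental solution in $T_y$, i.e. there is a function $\Gamma_y\in C^2(T_y\setminus\{y\})$ with $-\mathcal{L}\Gamma_y=\delta_y$ in $T_y$, where $\delta_y$ is the Dirac distribution at $y$. Assumption $({\rm A}_y^+)$: $({\rm A}_y)$ holds and, moreover, $\Gamma_y(x)>0$ in $T_y\setminus\{y\}$ and $\frac{1}{\Gamma_y}(y)=0$. Integrals over $\Omega$ involving $\mathcal{L}\Gamma_y$ are interpreted through the identity $-\mathcal{L}\Gamma_y=\delta_y$. Admissible domain: an open bounded set $\Omega\subset M$ whose boundary $\partial\Omega$ has no self-intersections and such that $$\sum_{k=1}^{N}\int_{\Omega}X_kf_k\,d\nu=\sum_{k=1}^{N}\int_{\partial\Omega}f_k\langle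 X_k,d\nu\rangle\qquad( * )$$ for all $f_k\in C^1(\Omega)\cap C(\overline{\Omega})$, $k=1,\ldots,N$. An admissible domain $\Omega$ is strongly admissible with $y\in M$ if $({\rm A}_y)$ is satisfied, $\Omega\subset T_y$, and $( * )$ holds for $f_k=vX_k\Gamma_y$ for all $v\in C^1(\Omega)\cap C(\overline{\Omega})$. *)

(* Defs.v *)
From HB Require Import structures.
From mathcomp Require Import all_boot all_order all_algebra.
From mathcomp Require Import all_classical all_reals all_analysis.

Set Implicit Arguments.
Unset Strict Implicit.
Unset Printing Implicit Defensive.

Import Order.TTheory GRing.Theory Num.Theory.
Import numFieldNormedType.Exports.

Local Open Scope classical_set_scope.
Local Open Scope ring_scope.

Section Euclidean.
Context {R : realType}.

Definition basis_vec n (a : 'I_n) : 'rV[R]_n := delta_mx 0 a.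

Fixpoint Ck n (k : nat) (U : set 'rV[R]_n) (f : 'rV[R]_n -> R) : Prop :=
  (forall z, U z -> {for z, continuous f}) /\
  if k is k'.+1 then
    forall a : 'I_n, (forall z, U z -> derivable f z (basis_vec a)) /\
      Ck k' U (fun z => 'D_(basis_vec a) f z)
  else True.

Definition smooth_on n (U : set 'rV[R]_n) (f : 'rV[R]_n -> R) : Prop :=
  forall k, Ck k U f.

(* The integral over R^n with respect to the Lebesgue measure, as an iterated
   one-dimensional Lebesgue integral.  It is only used on nonnegative Borel
   functions and on bounded Borel functions supported in the unit cube, where
   this is legitimate by Tonelli-Fubini. *)
Fixpoint iterint n : ('rV[R]_n -> \bar R) -> \bar R :=
  match n with
  | 0 => fun f => f 0
  | n'.+1 => fun f =>
      (\int[lebesgue_measure]_t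
         iterint (fun z : 'rV[R]_n' => f (row_mx (t%:M : 'rV[R]_1) z)))%E
  end.

Definition unit_cube n : set 'rV[R]_n :=
  [set s | forall i, 0 <= s 0 i <= 1].

Definition open_unit_cube n : set 'rV[R]_n :=
  [set s | forall i, 0 < s 0 i < 1].

End Euclidean.

Record smoothManifold (R : realType) (n : nat) := SmoothManifold {
  carrier :> ptopologicalType ;
  chart_index : Type ;
  dom : chart_index -> set carrier ;
  coord : chart_index -> carrier -> 'rV[R]_n ;
  coord_inv : chart_index -> 'rV[R]_n -> carrier ;
  chart_at : carrier -> chart_index ;
  manifold_hausdorff : hausdorff_space carrier ;
  manifold_second_countable : @second_countable carrier ;
  chart_atP : forall x, dom (chart_at x) x ;
  dom_open : forall i, open (dom i) ;
  codom_open : forall i, open (coord i @` dom i) ;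
  coordK : forall i x, dom i x -> coord_inv i (coord i x) = x ;
  coord_continuous : forall i x, dom i x -> {for x, continuous (coord i)} ;
  coord_inv_continuous : forall i z, (coord i @` dom i) z ->
    {for z, continuous (coord_inv i)} ;
  transition_smooth : forall i j (l : 'I_n),
    smooth_on (coord i @` (dom i `&` dom j))
      (fun z => coord j (coord_inv i z) 0 l)
}.

Section Manifold.
Context {R : realType} {n : nat} (M : smoothManifold R n).
Local Notation I := (chart_index M).

(* Row vectors are used for tangent vectors, so that the differential of the
   change of charts acts by v |-> v *m transition_jacobian i j x. *)
Definition transition_jacobian (i j : I) (x : M) : 'M[R]_n :=
  jacobian (coord j \o coord_inv i) (coord i x).

(* comp i x is the coordinate vector of the field at x in the chart i; it is
   meaningful for x in dom i only. *)
Record vectorField := VectorField {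
  comp : I -> M -> 'rV[R]_n ;
  comp_smooth : forall i l,
    smooth_on (coord i @` dom i) (fun z => comp i (coord_inv i z) 0 l) ;
  comp_change : forall i j x, dom i x -> dom j x ->
    comp j x = comp i x *m transition_jacobian i j x
}.

(* In the chart i, the volume form is dens i * dx_1 /\ .. /\ dx_n. *)
Record volumeForm := VolumeForm {
  dens : I -> M -> R ;
  dens_smooth : forall i,
    smooth_on (coord i @` dom i) (fun z => dens i (coord_inv i z)) ;
  dens_neq0 : forall i x, dom i x -> dens i x != 0 ;
  dens_change : forall i j x, dom i x -> dom j x ->
    dens i x = dens j x * \det (transition_jacobian i j x)
}.

Definition borelType := g_sigma_algebraType (@open M).

(* nu is the Borel measure of M defined by the volume form w, M being oriented
   by w. Since M is second countable, this determines nu. *)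
Definition volume_measure (w : volumeForm)
    (nu : {measure set borelType -> \bar R}) : Prop :=
  forall (i : I) (A : set borelType), measurable A -> A `<=` dom i ->
    nu A = iterint (fun z => (`|dens w i (coord_inv i z)| *
                              \1_(coord i @` A) z)%:E).

Definition integral_curve (V : vectorField) (x : M) (c : R -> M) : Prop :=
  c 0 = x /\
  exists2 e : R, 0 < e & forall t, `|t| < e ->
    {for t, continuous c} /\
    forall i, dom i (c t) -> is_derive t 1 (coord i \o c) (comp V i (c t)).

(* The integral curve of a smooth field through x is unique near time 0, so
   the choice made here is immaterial for the derivatives below. *)
Definition curve (V : vectorField) (x : M) : R -> M :=
  xget (fun=> x) [set c | integral_curve V x c].

Definition Xderivable (V : vectorField) (f : M -> R) (x : M) : Prop :=
  derivable (f \o curve V x) 0 1.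

Definition Xder (V : vectorField) (f : M -> R) (x : M) : R :=
  derive1 (f \o curve V x) 0.

(* The transpose of V with respect to nu:
   V^t phi = - div_nu (phi V) = - w^-1 \sum_a d_a (w V_a phi). *)
Definition Xtr (w : volumeForm) (V : vectorField) (phi : M -> R) (x : M) : R :=
  let i := chart_at x in
  - (dens w i x)^-1 *
  \sum_(a < n) 'D_(basis_vec a)
    (fun z => let p := coord_inv i z in dens w i p * comp V i p 0 a * phi p)
    (coord i x).

Definition smooth_fun (phi : M -> R) : Prop :=
  forall i, smooth_on (coord i @` dom i) (phi \o coord_inv i).

Definition test_function (T : set M) (phi : M -> R) : Prop :=
  [/\ smooth_fun phi,
      compact (closure [set x | phi x != 0]) &
      closure [set x | phi x != 0] `<=` T].

Definition bdry (Omega : set M) : set M := closure Omega `\` interior Omega.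

(* B, with the induced topology, is a topological m-manifold. *)
Definition locally_euclidean (m : nat) (B : set M) : Prop :=
  forall x, B x -> exists V : set M, [/\ open V, V x &
    exists (f : 'rV[R]_m -> M) (g : M -> 'rV[R]_m),
      [/\ continuous f, f @` setT = B `&` V, cancel f g &
          {within B `&` V, continuous g}]].

End Manifold.

Section SumOfSquares.
Context {R : realType} {n N : nat} {M : smoothManifold R n}.
Variable X : 'I_N -> vectorField M.

Definition C1X (U : set M) (f : M -> R) : Prop :=
  (forall x, U x -> {for x, continuous f}) /\
  forall k, (forall x, U x -> Xderivable (X k) f x) /\
            (forall x, U x -> {for x, continuous (Xder (X k) f)}).

Definition C2X (U : set M) (f : M -> R) : Prop :=
  C1X U f /\ forall k, C1X U (Xder (X k) f).

(* C^1(Omega) /\ C(closure Omega) *)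
Definition C1X_bar (Omega : set M) (f : M -> R) : Prop :=
  C1X Omega f /\ {within closure Omega, continuous f}.

Definition grad_sq (f : M -> R) (x : M) : R :=
  \sum_(k < N) (Xder (X k) f x) ^+ 2.

Definition grad_dot (f g : M -> R) (x : M) : R :=
  \sum_(k < N) Xder (X k) f x * Xder (X k) g x.

(* The components, in every chart, of the vector field
   \sum_k (X_k f) X_k. *)
Definition grad_field (f : M -> R) (i : chart_index M) (x : M) : 'rV[R]_n :=
  \sum_(k < N) Xder (X k) f x *: comp (X k) i x.

(* The formal transpose of \sum_k X_k^2. *)
Definition Ltr (w : volumeForm M) (phi : M -> R) (x : M) : R :=
  \sum_(k < N) Xtr w (X k) (Xtr w (X k) phi) x.

(* The values of Gamma and of its derivatives at y are irrelevant: Gamma is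
   only used on T `\ y, whose complement in T is a null set. *)
Record fundamental_solution (w : volumeForm M)
    (nu : {measure set (borelType M) -> \bar R})
    (T : set M) (y : M) (Gamma : M -> R) : Prop := {
  fs_open : open T ;
  fs_mem : T y ;
  fs_C2 : C2X (T `\ y) Gamma ;
  fs_locally_integrable : forall K : set M, compact K -> K `<=` T ->
    nu.-integrable (K `\ y) (EFin \o Gamma) ;
  fs_dirac : forall phi, test_function T phi ->
    - (\int[nu]_(x in T `\ y) (Gamma x * Ltr w phi x)) = phi y
}.

Definition positive_fundamental_solution (w : volumeForm M)
    (nu : {measure set (borelType M) -> \bar R})
    (T : set M) (y : M) (Gamma : M -> R) : Prop :=
  [/\ fundamental_solution w nu T y Gamma,
      forall x, (T `\ y) x -> 0 < Gamma x &
      (Gamma x)^-1 @[x --> y^'] --> (0 : R)].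

End SumOfSquares.

Section Boundary.
Context {R : realType} {n : nat} {M : smoothManifold R n.+1}.

(* An oriented piece of hypersurface, parametrized by the closed unit cube of
   R^n and contained in the domain of one chart; patch_map gives the
   coordinates in this chart. *)
Record boundaryPatch := BoundaryPatch {
  patch_chart : chart_index M ;
  patch_map : 'rV[R]_n -> 'rV[R]_n.+1 ;
  patch_sign : bool ;
  patch_C1 : exists U : set 'rV[R]_n, [/\ open U, unit_cube (n := n) `<=` U &
    forall l, Ck 1 U (fun s => patch_map s 0 l)] ;
  patch_dom : patch_map @` unit_cube (n := n)
                `<=` coord patch_chart @` dom patch_chart
}.

Definition patch_pt (P : boundaryPatch) (s : 'rV[R]_n) : M :=
  coord_inv (patch_chart P) (patch_map P s).

(* The boundary of Omega is piecewise C^1 without self-intersections, and it is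
   covered once by the oriented pieces S. *)
Record parametrized_boundary (Omega : set M) (m : nat) (S : 'I_m -> boundaryPatch)
  : Prop := {
  pb_cover : bdry Omega = \bigcup_j (patch_pt (S j) @` unit_cube (n := n)) ;
  pb_inj : forall j,
    {in open_unit_cube (n := n) &, injective (patch_pt (S j))} ;
  pb_disj : forall j k, j != k ->
    (patch_pt (S j) @` open_unit_cube (n := n)) `&`
    (patch_pt (S k) @` open_unit_cube (n := n)) = set0 ;
  pb_manifold : locally_euclidean n (bdry Omega)
}.

(* The integral over S of the n-form <V, dnu> = dnu(V, .), where V is given by
   its components in every chart: the pullback of <V, dnu> by a
   parametrization g is dens * det (V, d_1 g, .., d_n g). *)
Definition flux (w : volumeForm M) (m : nat) (S : 'I_m -> boundaryPatch)
    (V : chart_index M -> M -> 'rV[R]_n.+1) : R :=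
  \sum_(j < m) fine (iterint (fun s : 'rV[R]_n =>
    let i := patch_chart (S j) in
    let p := patch_pt (S j) s in
    ((-1) ^+ patch_sign (S j) * \1_(unit_cube (n := n)) s * dens w i p *
     \det (col_mx (V i p)
             (\matrix_(a < n) 'D_(basis_vec a) (patch_map (S j)) s)
           : 'M[R]_n.+1))%:E)).

Context {N : nat}.

(* The divergence identity is required whenever the integrals on its left-hand
   side exist: their existence does not follow from
   f_k \in C^1(Omega) /\ C(closure Omega). *)
Record admissible (X : 'I_N -> vectorField M) (w : volumeForm M)
    (nu : {measure set (borelType M) -> \bar R})
    (Omega : set M) (m : nat) (S : 'I_m -> boundaryPatch) : Prop := {
  adm_open : open Omega ;
  adm_bounded : compact (closure Omega) ;
  adm_boundary : parametrized_boundary Omega S ;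
  adm_divergence : forall f : 'I_N -> M -> R,
    (forall k, C1X_bar X Omega (f k)) ->
    (forall k, nu.-integrable Omega (EFin \o Xder (X k) (f k))) ->
    \sum_(k < N) (\int[nu]_(x in Omega) Xder (X k) (f k) x) =
    \sum_(k < N) flux w S (fun i x => f k x *: comp (X k) i x)
}.

(* For f_k = v X_k Gamma, the integrand on the left-hand side of the divergence
   identity is \sum_k (X_k v)(X_k Gamma) + v L Gamma, whose last term is
   integrated by means of - L Gamma = delta_y. *)
Record strongly_admissible (X : 'I_N -> vectorField M) (w : volumeForm M)
    (nu : {measure set (borelType M) -> \bar R}) (T : set M) (y : M)
    (Gamma : M -> R) (Omega : set M) (m : nat) (S : 'I_m -> boundaryPatch) : Prop := {
  sadm_admissible : admissible X w nu Omega S ;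
  sadm_fundamental : fundamental_solution X w nu T y Gamma ;
  sadm_sub : closure Omega `<=` T ;
  sadm_divergence : forall v : M -> R, C1X_bar X Omega v ->
    (forall k, nu.-integrable (Omega `\ y)
       (EFin \o (fun x => Xder (X k) v x * Xder (X k) Gamma x))) ->
    (\int[nu]_(x in Omega `\ y) grad_dot X v Gamma x) - \1_Omega y * v y =
    \sum_(k < N) flux w S
      (fun i x => (v x * Xder (X k) Gamma x) *: comp (X k) i x)
}.

End Boundary.
Arguments boundaryPatch {R n} M.

(* Main.v *)
Require Import Defs.
From HB Require Import structures.
From mathcomp Require Import all_boot all_order all_algebra.
From mathcomp Require Import all_classical all_reals all_analysis.
From mathcomp Require Import measurable_realfun.
From mathcomp Require Import ring lra.

Import Order.TTheory GRing.Theory Num.Theory.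
Import numFieldNormedType.Exports.

Local Open Scope classical_set_scope.
Local Open Scope ring_scope.

(* Let [W s = s^(alpha/(2-beta))].  If a nonnegative C^1 function [phi] of
   [Gamma] and a function [P >= 0] satisfy [phi^2/W + phi' + P <= 0], then the
   pointwise inequality [W |grad u|^2 >= 2 phi u grad u.grad Gamma
   - (phi^2/W) u^2 |grad Gamma|^2] and the divergence identity for
   [v = phi(Gamma) u^2] give
     [int W |grad u|^2 >= int P |grad Gamma|^2 u^2 + flux (v grad Gamma)]
   as soon as [v] vanishes near the pole.  This is achieved by multiplying
   [phi] and [P] by a nonincreasing cutoff in [Gamma], which preserves the
   differential inequality; the cutoff is then removed by monotone
   convergence.  With [a = alpha/(2-beta) - 1] and [c = 1/(2-beta)], the two
   inequalities are the cases [phi = -(a/2) s^a] and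
   [phi = -(a/2) s^a - (c/2) s^a / ln (r/s^c)]. *)

(** No value of L Gamma is ever used: it enters through the divergence identity only, as the Dirac
    term [v y], which is 0 when [v] vanishes near the pole. Since 1/Gamma tends to 0 at [y],
    truncating at high values of [Gamma] isolates the pole without any geometry of [M]. The
    condition [phi >= 0] is what lets a nonincreasing cutoff chi with values in [0, 1] pass through
    the differential inequality: chi^2 <= chi and chi' phi <= 0. It holds for both profiles because
    beta > 2 and alpha > 2 - beta make c and a negative, and because the bound on R makes the
    logarithm positive. Two obstacles shape the rest. The derivatives [X_k u] are continuous inside
    [Omega] only and may blow up at the boundary, so integrability of the test integrands is drawn
    from the weighted gradient integral itself; when that integral is infinite there is nothing to
    prove. And the flux is a finite part of iterated integrals, so its linearity, used to add the
    fluxes of the fields [X_k] and to separate the two boundary terms, must be earned from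
    continuity. *)

(** * Iterated integrals over the unit cube *)

Section cube_integral.
Context {R : realType}.

Lemma continuous_lin {T : topologicalType} (a : R) (g h : T -> R) :
  continuous g -> continuous h -> continuous (fun z => a * g z + h z).
Proof.
move=> gc hc z; apply: cvgD; last exact: hc.
by apply: cvgM; [exact: cvg_cst|exact: gc].
Qed.

Lemma cvg_mx_coord {T : Type} {F : set_system T} {FF : Filter F} (p q : nat)
    (f : T -> 'M[R]_(p, q)) (A : 'M[R]_(p, q)) :
  (forall i j, f x i j @[x --> F] --> A i j) -> f @ F --> A.
Proof.
move=> fA B [P AP PB]; apply: filterS PB _.
apply: filter_forall => i; apply: filter_forall => j; exact: fA (AP i j).
Qed.

Definition cube_integral {n} (g : 'rV[R]_n -> R) : R :=
  fine (iterint (fun z => (\1_(unit_cube (n:=n)) z * g z)%:E)).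

Local Notation cons_row t z := (row_mx (t%:M : 'rV[R]_1) z).

Lemma cons_row_continuous n (t : R) (z : 'rV[R]_n) :
  cons_row p.1 p.2 @[p --> (t, z)] --> cons_row t z.
Proof.
apply: cvg_mx_coord => i j; rewrite !mxE.
under eq_fun do rewrite !mxE.
case: splitP => k _.
- under eq_fun do rewrite mxE; rewrite mxE (ord1 i) (ord1 k) /=.
  exact: cvg_fst.
- apply: (cvg_comp snd (fun z0 : 'rV[R]_n => z0 i k)); first exact: cvg_snd.
  exact: coord_continuous.
Qed.

Lemma cons_row_head n t (z : 'rV[R]_n) (j : 'I_1) :
  (cons_row t z : 'rV[R]_n.+1) 0 (lshift n j : 'I_n.+1) = t.
Proof. by rewrite [LHS]row_mxEl mxE (ord1 j). Qed.

Lemma cons_row_tail n t (z : 'rV[R]_n) (i : 'I_n) :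
  (cons_row t z : 'rV[R]_n.+1) 0 (rshift 1 i : 'I_n.+1) = z 0 i.
Proof. exact: row_mxEr. Qed.

Lemma compact_unit_cube n : compact (@unit_cube R n).
Proof.
rewrite (_ : @unit_cube R n = [set v : 'rV[R]_n | forall i, `[0, 1]%classic (v ord0 i)]).
  by apply: (@rV_compact R n (fun=> `[0, 1]%classic)) => _; exact: segment_compact.
by apply/seteqP; split => v /= + i => /(_ i); rewrite in_itv.
Qed.

Lemma indic_unit_cubeS n t (z : 'rV[R]_n) :
  \1_(unit_cube (n:=n.+1)) (cons_row t z) =
  \1_(`[0, 1]%classic) t * \1_(unit_cube (n:=n)) z :> R.
Proof.
rewrite !indicE -natrM mulnb; congr ((nat_of_bool _)%:R).
apply/idP/andP => [|[]]; rewrite !inE /unit_cube /=.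
- move=> h; split.
    by move: (h (lshift n (ord0 : 'I_1))); rewrite in_itv cons_row_head.
  by move=> i; move: (h (rshift 1 i)); rewrite cons_row_tail.
- rewrite in_itv /= => ht hz i; rewrite -(@splitK 1 n i).
  case: (@fintype.split 1 n i) => j /=; first by rewrite cons_row_head.
  by rewrite cons_row_tail.
Qed.

(** For t outside [0, 1] the inner integrand is the zero function. That its recursively defined
    integral vanishes is left as a hypothesis; the induction below supplies it from the bound in
    dimension n. *)
Lemma iterint_cubeS n (g : 'rV[R]_n.+1 -> R) :
  iterint (fun z : 'rV[R]_n => (\1_(unit_cube (n:=n)) z * 0)%:E) = 0%E ->
  iterint (fun z => (\1_(unit_cube (n:=n.+1)) z * g z)%:E) =
  (\int[lebesgue_measure]_(t in `[0%R, 1%R])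
     iterint (fun z : 'rV[R]_n =>
       (\1_(unit_cube (n:=n)) z * g (cons_row t z))%:E))%E.
Proof.
move=> h0; rewrite /= [RHS]integral_mkcond; apply: eq_integral => t _.
rewrite patchE; case: ifPn => [t01|t01].
  congr iterint; apply/funext => z.
  by rewrite indic_unit_cubeS indicE t01 mul1r.
rewrite -[RHS]h0; congr iterint; apply/funext => z.
by rewrite indic_unit_cubeS indicE (negPf t01) !mul0r mulr0.
Qed.

(* Linearity in dimension n.+1 needs the continuity of the integral over the
   last n variables, which follows from linearity and the bound in dimension n:
   hence the joint induction. *)
Lemma cube_integral_props n :
  [/\ forall g : 'rV[R]_n -> R, continuous g ->
        iterint (fun z => (\1_(unit_cube (n:=n)) z * g z)%:E) =
        (cube_integral g)%:E,
      forall (a : R) (g h : 'rV[R]_n -> R), continuous g -> continuous h ->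
        cube_integral (fun z => a * g z + h z) =
        a * cube_integral g + cube_integral h &
      forall (g : 'rV[R]_n -> R) (b : R), continuous g ->
        (forall z, unit_cube z -> `|g z| <= b) -> `|cube_integral g| <= b].
Proof.
elim: n => [|n [fin lin bnd]].
  have E (g : 'rV[R]_0 -> R) : cube_integral g = g 0.
    by rewrite /cube_integral /= indicE mem_set ?mul1r//; case.
  split.
  - by move=> g _; rewrite /cube_integral /= indicE mem_set ?mul1r//; case.
  - by move=> a g h _ _; rewrite !E.
  - by move=> g b _ h; rewrite E; apply: h; case.
have h0 : iterint (fun z : 'rV[R]_n => (\1_(unit_cube (n:=n)) z * 0)%:E) = 0%E.
  have c0 : continuous (fun _ : 'rV[R]_n => 0 : R) by exact: cst_continuous.
  rewrite (fin (fun=> 0))//; congr (_%:E); apply/eqP.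
  by rewrite -normr_le0; apply: bnd => // z _; rewrite normr0.
pose J (g : 'rV[R]_n.+1 -> R) t := cube_integral (fun z : 'rV[R]_n => g (cons_row t z)).
have gt_cont (g : 'rV[R]_n.+1 -> R) t : continuous g ->
    continuous (fun z : 'rV[R]_n => g (cons_row t z)).
  move=> gc z; apply: (cvg_comp (fun z : 'rV[R]_n => cons_row t z) g); last exact: gc.
  have tz : (t, z0) @[z0 --> z] --> (t, z).
    apply: (@cvg_pair _ _ _ (nbhs z) (nbhs t) (nbhs z) _ _ _ (fun=> t) id).
      exact: cvg_cst.
    exact: cvg_id.
  exact: cvg_comp tz (cons_row_continuous n t z).
have Jc (g : 'rV[R]_n.+1 -> R) : continuous g -> continuous (J g : R -> R^o).
  move=> gc s; apply/cvgrPdist_le => e e0.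
  (* Compactness of the cube makes the continuity of [g] in its first variable uniform in the
     others; linearity and the bound in dimension n then control [J g s - J g t]. *)
  have : \forall t \near s, unit_cube (n:=n) `<=`
     (fun z => `|g (cons_row s z) - g (cons_row t z)| <= e).
    have /compact_near_coveringP nc := compact_unit_cube n.
    apply: (nc R (nbhs s)
      (fun t z => `|g (cons_row s z) - g (cons_row t z)| <= e)) => z _.
    have e2 : 0 < e / 2 by rewrite divr_gt0.
    have c1 : \forall p \near (s, z), `|g (cons_row s z) - g (cons_row p.1 p.2)| < e / 2.
      have h := cvg_comp _ g (cons_row_continuous n s z) (gc _).
      by move/cvgrPdist_lt : h; exact.
    have [[A B] /= [sA zB] AB] := c1.
    exists (B, A) => // -[z' t] /= [Bz' At].
    have H1 := AB (t, z') (conj At Bz').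
    have H2 := AB (s, z') (conj (nbhs_singleton sA) Bz').
    rewrite /= in H1 H2; apply/ltW; rewrite (splitr e).
    rewrite -(subrKA (g (cons_row s z))) addrC (le_lt_trans (ler_normD _ _))//.
    by rewrite ltrD// -opprB normrN.
  apply: filterS => t ht.
  have -> : J g s - J g t =
      cube_integral (fun z => (-1) * g (cons_row t z) + g (cons_row s z)).
    by rewrite lin; [rewrite mulN1r addrC|exact: gt_cont..].
  apply: bnd => [|z /ht]; last by rewrite mulN1r addrC.
  by apply: continuous_lin; exact: gt_cont.
have JI (g : 'rV[R]_n.+1 -> R) : continuous g ->
    (@lebesgue_measure R).-integrable `[0, 1] (EFin \o J g).
  move=> gc; apply: continuous_compact_integrable; first exact: segment_compact.
  by apply: continuous_subspaceT; exact: Jc.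
have itS (g : 'rV[R]_n.+1 -> R) : continuous g ->
    iterint (fun z => (\1_(unit_cube (n:=n.+1)) z * g z)%:E) =
    (\int[lebesgue_measure]_(t in `[0%R, 1%R]) (J g t)%:E)%E.
  move=> gc; rewrite iterint_cubeS//; apply: eq_integral => t _.
  by rewrite fin//; exact: gt_cont.
have cS (g : 'rV[R]_n.+1 -> R) : continuous g ->
    cube_integral g = \int[lebesgue_measure]_(t in `[0%R, 1%R]) J g t.
  by move=> gc; rewrite /cube_integral itS.
have m01 : measurable (`[0%R, 1%R] : set (measurableTypeR R)) by exact: measurable_itv.
split.
- move=> g gc; rewrite /cube_integral itS// fineK//.
  exact: integrable_fin_num (JI g gc).
- move=> a g h gc hc.
  have agc : continuous (fun z => a * g z + h z).
    exact: continuous_lin.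
  rewrite !cS//.
  have -> : J (fun z => a * g z + h z) = (fun t => a * J g t + J h t).
    by apply/funext => t; rewrite /J lin//; exact: gt_cont.
  rewrite RintegralD//; [|exact: (integrableZl m01 a (JI g gc))|exact: JI].
  by rewrite RintegralZl//; exact: JI.
- move=> g b gc gb; rewrite cS//.
  apply: le_trans (le_normr_Rintegral m01 (JI g gc)) _.
  have Jb t : `[0, 1]%classic t -> `|J g t| <= b.
    move=> t01; apply: bnd => [|z z1]; first exact: gt_cont.
    apply: gb; have := indic_unit_cubeS n t z.
    rewrite !indicE (mem_set t01) (mem_set z1) mulr1.
    case: (boolP (_ \in _)) => [/set_mem//|_ /eqP].
    by rewrite eq_sym oner_eq0.
  have bi : (@lebesgue_measure R).-integrable `[0, 1] (EFin \o fun=> b).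
    apply: continuous_compact_integrable; first exact: segment_compact.
    by apply: continuous_subspaceT; exact: cst_continuous.
  have -> : b = \int[lebesgue_measure]_(t in `[0%R, 1%R]) b.
    rewrite Rintegral_cst// [X in fine X](_ : _ = 1%E) ?mulr1//.
    apply: etrans (lebesgue_measure_itv `[0, 1]) _.
    by rewrite /= lte_fin ltr01 oppr0 adde0.
  apply: le_Rintegral => //.
  exact: (integrable_norm (JI g gc)).
Qed.

End cube_integral.

(** * Continuity relative to a set *)

Section cont_on.
Context {R : realType}.

(** The pointwise form of relative continuity, to which limit rules such as [cvgD] and [cvgM] apply
    directly. At boundary points [u] is known to be continuous only within [closure Omega]. *)
Definition cont_on {T U : topologicalType} (A : set T) (f : T -> U) : Prop :=
  forall x, A x -> f z @[z --> within A (nbhs x)] --> f x.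

Lemma cont_onP {T U : topologicalType} (A : set T) (f : T -> U) :
  {within A, continuous f} <-> cont_on A f.
Proof. exact: subspace_continuousP. Qed.

Lemma cont_on_for {T U : topologicalType} (A : set T) (f : T -> U) :
  (forall x, A x -> {for x, continuous f}) -> cont_on A f.
Proof. 
by move=> fc x Ax; apply: cvg_trans (fc x Ax); apply: cvg_app; exact: cvg_within.
Qed.

Lemma cont_on_eq {T U : topologicalType} (A : set T) (f g : T -> U) :
  (forall x, A x -> f x = g x) -> cont_on A f -> cont_on A g.
Proof.
move=> fg fc x Ax; rewrite -(fg _ Ax); apply: cvg_trans (fc x Ax).
apply: near_eq_cvg; rewrite near_withinE; apply: nearW => z /fg ->; exact: erefl.
Qed.

Lemma cont_on_sub {T U : topologicalType} (A B : set T) (f : T -> U) :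
  A `<=` B -> cont_on B f -> cont_on A f.
Proof.
move=> AB fc x Ax C fC; have := fc x (AB _ Ax) C fC.
rewrite !nbhs_simpl /fmap /= /within /= => h; apply: filterS h => z h /AB; exact: h.
Qed.

Lemma cont_on_comp {T U W : topologicalType} (A : set T) (B : set U)
    (f : T -> U) (g : U -> W) :
  (forall x, A x -> B (f x)) -> cont_on A f -> cont_on B g ->
  cont_on A (g \o f).
Proof.
move=> AB fc gc x Ax; apply: cvg_comp (gc _ (AB x Ax)) => C BC.
have := fc x Ax _ BC.
rewrite !nbhs_simpl /fmap /= /within /=.
by apply: filterS => z h Az; apply: h => //; exact: AB.
Qed.

Lemma cont_on_cst {T U : topologicalType} (A : set T) (c : U) :
  cont_on A (fun=> c).
Proof. by move=> x Ax; exact: cvg_cst. Qed.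

Lemma cont_onD {T : topologicalType} (A : set T) (f g : T -> R) :
  cont_on A f -> cont_on A g -> cont_on A (fun x => f x + g x).
Proof. by move=> fc gc x Ax; apply: cvgD; [exact: fc|exact: gc]. Qed.

Lemma cont_onM {T : topologicalType} (A : set T) (f g : T -> R) :
  cont_on A f -> cont_on A g -> cont_on A (fun x => f x * g x).
Proof. by move=> fc gc x Ax; apply: cvgM; [exact: fc|exact: gc]. Qed.

Lemma cont_on_sum {T : topologicalType} (A : set T) (I : Type) (r : seq I)
    (P : pred I) (F : I -> T -> R) :
  (forall i, cont_on A (F i)) ->
  cont_on A (fun x => \sum_(i <- r | P i) F i x).
Proof.
move=> Fc; elim: r => [|i r IH].
  by under eq_fun do rewrite big_nil; exact: cont_on_cst.
under eq_fun do rewrite big_cons.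
by case: (P i) => //; exact: cont_onD.
Qed.

Lemma cont_on_prod {T : topologicalType} (A : set T) (I : Type) (r : seq I)
    (P : pred I) (F : I -> T -> R) :
  (forall i, cont_on A (F i)) ->
  cont_on A (fun x => \prod_(i <- r | P i) F i x).
Proof.
move=> Fc; elim: r => [|i r IH].
  by under eq_fun do rewrite big_nil; exact: cont_on_cst.
under eq_fun do rewrite big_cons.
by case: (P i) => //; exact: cont_onM.
Qed.

Lemma cont_on_det {T : topologicalType} (A : set T) n (F : T -> 'M[R]_n) :
  (forall i j, cont_on A (fun x => F x i j)) -> cont_on A (fun x => \det (F x)).
Proof.
move=> Fc; apply: cont_on_sum => s; apply: cont_onM; first exact: cont_on_cst.
apply: cont_on_prod => i; exact: Fc.
Qed.

Lemma cont_on_mx {T : topologicalType} (A : set T) p q (F : T -> 'M[R]_(p, q)) :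
  (forall i j, cont_on A (fun x => F x i j)) -> cont_on A F.
Proof. by move=> Fc x Ax; apply: cvg_mx_coord => i j; exact: Fc. Qed.

(** A retraction onto the cube: composition with it extends a function continuous on the cube to a
    continuous function on the whole space with the same cube integral. *)
Definition clamp n (z : 'rV[R]_n) : 'rV[R]_n :=
  \row_i Num.max 0 (Num.min 1 (z 0 i)).

Lemma clamp_unit_cube n (z : 'rV[R]_n) : unit_cube (clamp n z).
Proof.
move=> i; rewrite mxE le_max lexx /= ge_max ler01 ge_min lexx //.
Qed.

Lemma clamp_id n (z : 'rV[R]_n) : unit_cube z -> clamp n z = z.
Proof.
move=> z01; apply/rowP => i; rewrite mxE.
have /andP[z0 z1] := z01 i.
by rewrite (elimT min_idPr)// (elimT max_idPr).
Qed.

Lemma clamp_continuous n : continuous (clamp n).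
Proof.
move=> z; apply: (@cvg_mx_coord R _ (nbhs z)) => i j; rewrite !mxE.
under eq_fun do rewrite mxE.
have zc : (z0 : 'rV[R]_n) 0 j @[z0 --> z] --> z 0 j by exact: coord_continuous.
have h (x : R) : {for x, continuous (fun t : R => Num.max 0 (Num.min 1 t))}.
  apply: (@continuous_max R R (fun=> 0)); first exact: cvg_cst.
  by apply: (@continuous_min R R (fun=> 1)); [exact: cvg_cst|exact: cvg_id].
exact: cvg_comp zc (h _).
Qed.

Lemma cube_integral_clamp n (g : 'rV[R]_n -> R) :
  cube_integral g = cube_integral (g \o clamp n).
Proof.
congr (fine (iterint _)); apply/funext => z; congr (_%:E).
rewrite indicE; case: (boolP (_ \in _)) => [/set_mem zc|]; last by rewrite !mul0r.
by rewrite /= clamp_id.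
Qed.

Lemma cube_integral_lin n (a : R) (g h : 'rV[R]_n -> R) :
  cont_on (unit_cube (n:=n)) g -> cont_on (unit_cube (n:=n)) h ->
  cube_integral (fun z => a * g z + h z) =
  a * cube_integral g + cube_integral h.
Proof.
have cc (k : 'rV[R]_n -> R) : cont_on (unit_cube (n:=n)) k -> continuous (k \o clamp n).
  move=> kc z.
  have : cont_on setT (k \o clamp n).
    apply: (cont_on_comp setT (unit_cube (n:=n)) (clamp n) k) => // [x _|].
      exact: clamp_unit_cube.
    by apply: cont_on_for => x _; exact: clamp_continuous.
  by move=> /(_ z I); rewrite withinET.
have [_ lin _] := @cube_integral_props R n.
move=> /cc gc /cc hc.
rewrite (cube_integral_clamp _ g) (cube_integral_clamp _ h).
by rewrite -lin// cube_integral_clamp.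
Qed.

End cont_on.

(** * Linearity of the flux through a parametrized boundary *)

Section flux.
Context {R : realType} {n : nat} {M : smoothManifold R n.+1}.
Variable w : volumeForm M.
Local Notation family := (chart_index M -> M -> 'rV[R]_n.+1).

Definition flux_density (P : boundaryPatch M) (V : family) (s : 'rV[R]_n) : R :=
  (-1) ^+ patch_sign P * dens w (patch_chart P) (patch_pt P s) *
  \det (col_mx (V (patch_chart P) (patch_pt P s))
          (\matrix_(a < n) 'D_(basis_vec a) (patch_map P) s) : 'M[R]_n.+1).

Lemma fluxE {m} (S : 'I_m -> boundaryPatch M) (V : family) :
  flux w S V = \sum_(j < m) cube_integral (flux_density (S j) V).
Proof.
apply: eq_bigr => j _; congr (fine (iterint _)); apply/funext => s /=.
by rewrite /flux_density; congr (_%:E); ring.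
Qed.

Lemma det_col_mx_lin (a : R) (u v : 'rV[R]_n.+1) (B : 'M[R]_(n, n.+1)) :
  \det (col_mx (a *: u + v) B : 'M[R]_n.+1) =
  a * \det (col_mx u B : 'M[R]_n.+1) + \det (col_mx v B : 'M[R]_n.+1).
Proof.
transitivity (a * \det (col_mx u B : 'M[R]_n.+1) +
    1 * \det (col_mx v B : 'M[R]_n.+1)); last by rewrite mul1r.
pose i0 : 'I_n.+1 := lshift n (ord0 : 'I_1).
have row0 (z : 'rV[R]_n.+1) : row i0 (col_mx z B) = z.
  by apply/rowP => j; rewrite mxE [LHS]col_mxEu.
have row'0 (z t : 'rV[R]_n.+1) : row' i0 (col_mx z B) =
    row' i0 (col_mx t B).
  apply/matrixP => i j; rewrite !mxE.
  case: splitP => // k; rewrite (ord1 k) /= => h.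
  by have := neq_bump 0 i; rewrite h.
apply: (determinant_multilinear (i0 := i0)) => //.
by rewrite !row0 scale1r.
Qed.

Lemma flux_density_lin (P : boundaryPatch M) (a : R) (V W : family) :
  flux_density P (fun i x => a *: V i x + W i x) =
  (fun s => a * flux_density P V s + flux_density P W s).
Proof. by apply/funext => s; rewrite /flux_density det_col_mx_lin; ring. Qed.

(** A condition under which the integrals hidden by [fine] are finite and additive. *)
Definition flux_regular {m} (S : 'I_m -> boundaryPatch M) (V : family) : Prop :=
  forall j, cont_on (unit_cube (n:=n)) (flux_density (S j) V).

Lemma flux_regular_lin {m} (S : 'I_m -> boundaryPatch M) (a : R) (V W : family) :
  flux_regular S V -> flux_regular S W ->
  flux_regular S (fun i x => a *: V i x + W i x).
Proof.
move=> Vr Wr j; rewrite flux_density_lin.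
by apply: cont_onD => //; apply: cont_onM => //; exact: cont_on_cst.
Qed.

Lemma flux_lin {m} (S : 'I_m -> boundaryPatch M) (a : R) (V W : family) :
  flux_regular S V -> flux_regular S W ->
  flux w S (fun i x => a *: V i x + W i x) = a * flux w S V + flux w S W.
Proof.
move=> Vr Wr; rewrite !fluxE mulr_sumr -big_split /=; apply: eq_bigr => j _.
by rewrite flux_density_lin cube_integral_lin.
Qed.

Lemma flux_density_sum (I : Type) (r : seq I) P (V : I -> family) :
  flux_density P (fun i x => \sum_(k <- r) V k i x) =
  (fun s => \sum_(k <- r) flux_density P (V k) s).
Proof.
apply/funext => s.
elim: r => [|k r IH].
  rewrite big_nil.
  (* The zero field is written [-1 *: 0 + 0] so that linearity alone yields - z + z = 0. *)
  have -> : (fun i x => \sum_(k <- [::]) V k i x) =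
      (fun _ _ => -1 *: 0 + 0) :> family.
    by apply/funext => i; apply/funext => x; rewrite big_nil scaler0 addr0.
  by rewrite (flux_density_lin P (-1) (fun _ _ => 0) (fun _ _ => 0)) mulN1r addNr.
have -> : (fun i x => \sum_(k0 <- k :: r) V k0 i x) =
    (fun i x => 1 *: V k i x + \sum_(k <- r) V k i x).
  by apply/funext => i; apply/funext => x; rewrite big_cons scale1r.
by rewrite flux_density_lin big_cons IH mul1r.
Qed.

Lemma flux_sum {m} (S : 'I_m -> boundaryPatch M) (I : Type) (r : seq I)
    (V : I -> family) : (forall k, flux_regular S (V k)) ->
  flux_regular S (fun i x => \sum_(k <- r) V k i x) /\
  flux w S (fun i x => \sum_(k <- r) V k i x) = \sum_(k <- r) flux w S (V k).
Proof.
move=> Vr; elim: r => [|k r [IHr IH]].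
  split=> [j|].
    rewrite flux_density_sum.
    by under eq_fun do rewrite big_nil; exact: cont_on_cst.
  rewrite big_nil fluxE big1// => j _.
  have -> : flux_density (S j) (fun i x => \sum_(k <- [::]) V k i x) = (fun=> -1 * 0 + 0).
    by apply/funext => s; rewrite flux_density_sum big_nil mulr0 addr0.
  rewrite cube_integral_lin; [|exact: cont_on_cst..].
  by rewrite mulN1r addNr.
have E : (fun i x => \sum_(k0 <- k :: r) V k0 i x) =
   (fun i x => 1 *: V k i x + \sum_(k <- r) V k i x).
  by apply/funext => i; apply/funext => x; rewrite big_cons scale1r.
by rewrite E; split; [exact: flux_regular_lin|rewrite flux_lin// big_cons mul1r IH].
Qed.

Section boundary.
Context {Omega : set M} {m : nat} {S : 'I_m -> boundaryPatch M}.
Hypothesis pbS : parametrized_boundary Omega S.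

Lemma patch_pt_bdry j s : unit_cube (n:=n) s -> bdry Omega (patch_pt (S j) s).
Proof. by move=> sc; rewrite (pb_cover pbS); exists j => //; exists s. Qed.

(** Clamping sends every parameter into the cube, hence every patch point to the boundary. There
    [off] has no effect and cutoffs of large index equal 1, so both can be erased from a flux. *)
Lemma eq_flux (V W : family) :
  (forall i x, bdry Omega x -> V i x = W i x) -> flux w S V = flux w S W.
Proof.
move=> VW; rewrite !fluxE; apply: eq_bigr => j _.
rewrite cube_integral_clamp [RHS]cube_integral_clamp; congr cube_integral.
apply/funext => s /=; rewrite /flux_density VW//.
exact/patch_pt_bdry/clamp_unit_cube.
Qed.

Lemma patch_map_cont_on j : cont_on (unit_cube (n:=n)) (patch_map (S j)).
Proof.
have [U [_ cU UC1]] := patch_C1 (S j).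
apply: cont_on_mx => i l; rewrite (ord1 i); apply: cont_on_for => s /cU Us.
by have [+ _] := UC1 l; exact.
Qed.

Lemma coord_cont_on {W : topologicalType} j (g : 'rV[R]_n.+1 -> W) :
  (forall z, (Defs.coord (patch_chart (S j)) @` dom (patch_chart (S j))) z ->
     {for z, continuous g}) ->
  cont_on (unit_cube (n:=n)) (g \o patch_map (S j)).
Proof.
move=> gc; apply: (cont_on_comp _
  (Defs.coord (patch_chart (S j)) @` dom (patch_chart (S j)))
  _ _ _ (patch_map_cont_on j)) => [s sc|].
  by apply: (patch_dom (b := S j)); exists s.
exact: cont_on_for.
Qed.

Lemma patch_pt_cont_on j : cont_on (unit_cube (n:=n)) (patch_pt (S j)).
Proof. by apply: coord_cont_on => z; exact: coord_inv_continuous. Qed.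

Lemma patch_map_derive_cont_on j a l :
  cont_on (unit_cube (n:=n)) (fun s => 'D_(basis_vec a) (patch_map (S j)) s 0 l).
Proof.
have [U [_ cU UC1]] := patch_C1 (S j).
have dl k s : U s -> derivable (fun s => patch_map (S j) s 0 k) s (basis_vec a).
  by move=> Us; have [_ /(_ a)[+ _]] := UC1 k; exact.
apply: (cont_on_eq _ (fun s => 'D_(basis_vec a) (fun s => patch_map (S j) s 0 l) s)).
  move=> s /cU Us; rewrite derive_mx ?mxE//.
  by apply/derivable_mxP => i k; rewrite (ord1 i); exact: dl.
by apply: cont_on_for => s /cU Us; have [_ /(_ a)[_ [+ _]]] := UC1 l; exact.
Qed.

(** The density is, up to sign, [dens] times a determinant whose first row is [f] times the
    components of [X] and whose other rows are derivatives of the parametrization; all entries are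
    continuous on the cube. *)
Lemma flux_regular_field (f : M -> R) (X : vectorField M) :
  cont_on (bdry Omega) f -> flux_regular S (fun i x => f x *: Defs.comp X i x).
Proof.
move=> fc j; apply: cont_onM.
  apply: cont_onM; first exact: cont_on_cst.
  apply: (coord_cont_on j
    (fun z => dens w (patch_chart (S j)) (coord_inv (patch_chart (S j)) z))).
  by move=> z zc; have [+ _] := dens_smooth w (patch_chart (S j)) 0; exact.
apply: cont_on_det => a b.
rewrite -(@splitK 1 n a); case: (@fintype.split 1 n a) => k /=.
  apply: (cont_on_eq _ (fun s => f (patch_pt (S j) s) *
      Defs.comp X (patch_chart (S j)) (patch_pt (S j) s) 0 b)) => [s _|].
    by rewrite [RHS]col_mxEu mxE (ord1 k).
  apply: cont_onM.
    exact: (cont_on_comp _ _ _ _ (patch_pt_bdry j) (patch_pt_cont_on j) fc).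
  apply: (coord_cont_on j (fun z =>
    Defs.comp X (patch_chart (S j)) (coord_inv (patch_chart (S j)) z) 0 b)).
  by move=> z zc; have [+ _] := comp_smooth X (patch_chart (S j)) b 0; exact.
apply: (cont_on_eq _ _ _ _ (patch_map_derive_cont_on j k b)) => s _.
by rewrite [RHS]col_mxEd mxE.
Qed.

End boundary.
End flux.

(** * A C^1 cutoff, monotone in its argument and in its index *)

Section cutoff.
Context {R : realType}.

(** Squaring makes the positive part C^1, so that nesting two copies gives a C^1 cutoff with an
    explicit derivative. *)
Definition pos_sq (t : R) : R := Num.max 0 t ^+ 2.

Lemma pos_part_continuous : continuous (fun t : R => Num.max 0 t).
Proof.
move=> t; apply: (@continuous_max R R (fun=> 0)); first exact: cvg_cst.
exact: cvg_id.
Qed.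

Lemma pos_sq_derive (t : R) : is_derive t 1 pos_sq (2 * Num.max 0 t).
Proof.
have [t0|t0|->] := ltgtP t 0.
- rewrite mulr0.
  apply: (near_eq_is_derive (f := cst (0 : R))).
  near=> x; rewrite /pos_sq max_l ?expr0n//.
  by apply/ltW; near: x; exact: lt_nbhsl.
- apply: (near_eq_is_derive (f := fun x : R => x ^+ 2)).
    near=> x; rewrite /pos_sq max_r//.
    by apply/ltW; near: x; exact: lt_nbhsr.
  by apply: is_derive_eq; rewrite [_%:A]mulr1 -mulr2n mulr_natl.
- rewrite mulr0.
  (* At 0 the difference quotient is [max 0 h] itself. *)
  have q : h^-1 *: (pos_sq (h *: 1 + 0) - pos_sq 0) @[h --> 0^'] --> (0 : R).
    have mx : Num.max 0 h @[h --> (0 : R)^'] --> (0 : R).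
      have := pos_part_continuous 0; rewrite /continuous_at maxxx => mx.
      by apply: cvg_trans mx; apply: cvg_app; exact: cvg_within.
    apply: cvg_trans mx.
    apply: near_eq_cvg; near=> h.
    have h0 : h != 0 by near: h; exact: nbhs_dnbhs_neq.
    rewrite /pos_sq maxxx expr0n subr0 addr0 /GRing.scale /= mulr1.
    case: (leP 0 h) => [hp|hn]; first by rewrite expr2 mulKf.
    by rewrite expr0n mulr0.
  by apply: DeriveDef; [apply/cvg_ex; exists 0|exact: cvg_lim q].
Unshelve. all: by end_near. Qed.

Lemma pos_sq_homo (s t : R) : s <= t -> pos_sq s <= pos_sq t.
Proof.
move=> st; rewrite /pos_sq ler_sqr ?nnegrE; [|by rewrite le_max lexx..].
by rewrite ge_max !le_max lexx st orbT.
Qed.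

(* Equal to 1 up to n and to 0 from n + 1 on. *)
Definition cutoff (n : nat) (s : R) : R := pos_sq (1 - pos_sq (s - n%:R)).

Definition dcutoff (n : nat) (s : R) : R :=
  2 * Num.max 0 (1 - pos_sq (s - n%:R)) * - (2 * Num.max 0 (s - n%:R)).

Lemma cutoff_derive n (s : R) : is_derive s 1 (cutoff n) (dcutoff n s).
Proof.
have d1 : is_derive s 1 (fun s : R => s - n%:R) 1.
  by apply: is_derive_eq; rewrite subr0.
have d2 := is_derive1_comp (f := pos_sq) (g := fun s => s - n%:R) (pos_sq_derive _) d1.
have d3 : is_derive s 1 (fun s : R => 1 - pos_sq (s - n%:R))
    (- (2 * Num.max 0 (s - n%:R))).
  by rewrite mulr1 in d2; apply: is_derive_eq; rewrite add0r mul1r.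
exact: (is_derive1_comp (f := pos_sq) (g := fun s => 1 - pos_sq (s - n%:R))
  (pos_sq_derive _) d3).
Qed.

Lemma dcutoff_continuous n : continuous (dcutoff n).
Proof.
have ps : continuous pos_sq.
  by move=> t; apply: cvgM; exact: pos_part_continuous.
have c1 : continuous (fun s : R => s - n%:R).
  by move=> s; apply: cvgB; [exact: cvg_id|exact: cvg_cst].
move=> s; apply: cvgM.
  apply: cvgM; first exact: cvg_cst.
  apply: (continuous_comp (f := fun s : R => 1 - pos_sq (s - n%:R)));
    last exact: pos_part_continuous.
  apply: cvgB; first exact: cvg_cst.
  by apply: (continuous_comp (f := fun s : R => s - n%:R)); [exact: c1|exact: ps].
apply: cvgN; apply: cvgM; first exact: cvg_cst.
by apply: (continuous_comp (f := fun s : R => s - n%:R));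
  [exact: c1|exact: pos_part_continuous].
Qed.

Lemma cutoff_ge0 n (s : R) : 0 <= cutoff n s. Proof. exact: sqr_ge0. Qed.

Lemma pos_sq_npos (t : R) : t <= 0 -> pos_sq t = 0.
Proof. by move=> t0; rewrite /pos_sq max_l ?expr0n. Qed.

Lemma pos_sq1 : pos_sq (1 : R) = 1.
Proof. by rewrite /pos_sq max_r ?expr1n. Qed.

Lemma cutoff_le1 n (s : R) : cutoff n s <= 1.
Proof. by rewrite -[leRHS]pos_sq1; apply: pos_sq_homo; rewrite gerBl sqr_ge0. Qed.

Lemma cutoff1 n (s : R) : s <= n%:R -> cutoff n s = 1.
Proof. by move=> sn; rewrite /cutoff (pos_sq_npos (s - _)) ?subr_le0// subr0 pos_sq1. Qed.

Lemma cutoff0 n (s : R) : n.+1%:R <= s -> cutoff n s = 0.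
Proof.
move=> ns; rewrite /cutoff pos_sq_npos// subr_le0 -[leLHS]pos_sq1.
by apply: pos_sq_homo; rewrite lerBrDr addrC natr1.
Qed.

Lemma dcutoff_le0 n (s : R) : dcutoff n s <= 0.
Proof.
by rewrite /dcutoff mulrN oppr_le0 !mulr_ge0// le_max lexx.
Qed.

Lemma dcutoff0 n (s : R) : n.+1%:R <= s -> dcutoff n s = 0.
Proof.
move=> ns; rewrite /dcutoff max_l ?mulr0 ?mul0r//.
rewrite subr_le0 -[leLHS]pos_sq1.
by apply: pos_sq_homo; rewrite lerBrDr addrC natr1.
Qed.

(** This makes the truncated integrands increase with the index, as monotone convergence
    requires. *)
Lemma cutoff_homo n m (s : R) : (n <= m)%N -> cutoff n s <= cutoff m s.
Proof.
move=> nm; apply: pos_sq_homo; rewrite lerB// pos_sq_homo// lerB//.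
by rewrite ler_nat.
Qed.

End cutoff.

(** * Differentiation along a vector field *)

Section field_derivative.
Context {R : realType} {n : nat} {M : smoothManifold R n}.
Variable V : vectorField M.
Implicit Types (f g : M -> R) (x : M).

Lemma curve0 x : curve V x 0 = x.
Proof. by rewrite /curve; case: xgetP => // c _ []. Qed.

Lemma curve_continuous0 x : curve V x t @[t --> (0 : R)] --> x.
Proof.
rewrite /curve; case: xgetP => [c _ [c0 [e e0 ce]]|_]; last exact: cvg_cst.
by rewrite -c0; have [|+ _] := ce 0; [rewrite normr0|exact].
Qed.

(* Only one curve through x, continuous at time 0, enters here: differentiation
   along V obeys the one-variable rules without any existence theorem for
   integral curves. *)
Definition is_Xder f x (l : R) : Prop := is_derive (0 : R) 1 (f \o curve V x) l.

Lemma is_XderP f x l : is_Xder f x l <-> Xderivable V f x /\ Xder V f x = l.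
Proof.
rewrite /is_Xder /Xderivable /Xder derive1E.
by split=> [h|[h1 <-]]; [split; [exact: ex_derive|exact: derive_val]|exact: DeriveDef].
Qed.

(** The curve is continuous at time 0, so for small times it stays where [f] and [g] agree. *)
Lemma is_Xder_near f g x l :
  (\forall z \near x, f z = g z) -> is_Xder f x l -> is_Xder g x l.
Proof. by move=> fg; apply: near_eq_is_derive; exact: curve_continuous0 fg. Qed.

Lemma is_Xder_cst (c : R) x : is_Xder (fun=> c) x 0.
Proof. exact: is_derive_cst. Qed.

Lemma is_XderM f g x (a b : R) : is_Xder f x a -> is_Xder g x b ->
  is_Xder (fun z => f z * g z) x (f x * b + g x * a).
Proof.
by rewrite /is_Xder => fa gb; have := is_deriveM fa gb; rewrite /= curve0; exact.
Qed.

Lemma is_Xder_comp (F : R -> R) f x (a b : R) :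
  is_derive (f x) 1 F a -> is_Xder f x b -> is_Xder (F \o f) x (a * b).
Proof.
rewrite /is_Xder => Fa fb; apply: (is_derive1_comp (f := F) (g := f \o curve V x)) fb.
by rewrite /= curve0.
Qed.

End field_derivative.

(** * Functions near a removed point, and Borel measurability *)

Section point_removal.
Context {R : realType} {n : nat} {M : smoothManifold R n}.
Implicit Types (A U : set M) (f h : M -> R) (x y : M).

Lemma cont_on_nbhs A f x : nbhs x A -> cont_on A f -> {for x, continuous f}.
Proof.
move=> xA fc B fB; have := fc x (nbhs_singleton xA) B fB.
rewrite !nbhs_simpl /fmap /= /within /= => h.
by apply: filterS2 xA h => z Az; apply.
Qed.

Lemma cont_on_bounded A f : compact A -> cont_on A f ->
  exists2 C : R, 0 < C & forall x, A x -> `|f x| <= C.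
Proof.
move=> cA /cont_onP fc.
have [C [Cr hC]] := compact_bounded (continuous_compact fc cA).
have C1 : C < `|C| + 1 by rewrite (le_lt_trans (ler_norm _))// ltrDl.
exists (`|C| + 1); first by rewrite ltr_wpDl.
by move=> x Ax; apply: hC C1 _ _; exists x.
Qed.

Lemma open_setD1 U y : open U -> open (U `\ y).
Proof.
move=> oU; rewrite setDE; apply: openI => //; rewrite openC.
apply: accessible_closed_set1; apply: hausdorff_accessible.
exact: manifold_hausdorff.
Qed.

Lemma nbhs_neq x y : x != y -> \forall z \near x, z != y.
Proof.
move=> xy; have : nbhs x (setT `\ y).
  apply: open_nbhs_nbhs; split; first exact/open_setD1/openT.
  by split => // /eqP; rewrite (negPf xy).
by apply: filterS => z [_ /eqP].
Qed.

Lemma cont_on_setD1 A h y : cont_on (A `\ y) h ->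
  forall x, A x -> x != y -> h z @[z --> within A (nbhs x)] --> h x.
Proof.
move=> hc x Ax xy B hB.
have := hc x (conj Ax (elimN eqP xy)) B hB.
rewrite !nbhs_simpl /fmap /= /within /= => k.
apply: filterS2 (nbhs_neq x y xy) k => z zy k Az.
by apply: k; split => //; exact/eqP.
Qed.

(* The value of Gamma at the pole is arbitrary, so functions of Gamma are reset
   to 0 there. *)
Definition off y h x : R := if x == y then 0 else h x.

Lemma off_neq y h x : x != y -> off y h x = h x.
Proof. by rewrite /off => /negPf ->. Qed.

Lemma off_near y h x : x != y -> \forall z \near x, off y h z = h z.
Proof. by move=> /nbhs_neq h0; apply: (filterS _ h0) => z; exact: off_neq. Qed.

Lemma off_near0 y h : (\forall x \near y^', h x = 0) ->
  \forall x \near y, off y h x = 0.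
Proof.
rewrite near_withinE => h0; apply: (filterS _ h0) => x hx; rewrite /off.
by have [//|/hx] := eqVneq x y.
Qed.

Lemma cvg_dnbhs_near0 y h :
  (\forall x \near y^', h x = 0) -> h x @[x --> y^'] --> (0 : R).
Proof. by move=> h0; apply: cvg_near_cst. Qed.

(** The limit 0 at the pole makes the reset value the right one. This covers 1/Gamma as well as
    functions truncated near [y]. *)
Lemma off_cont_on A y h : h x @[x --> y^'] --> (0 : R) ->
  cont_on (A `\ y) h -> cont_on A (off y h).
Proof.
move=> h0 hc x Ax; have [->|xy] := eqVneq x y.
  rewrite {2}/off eqxx => B B0; have := h0 B B0.
  rewrite !nbhs_simpl /fmap /= /dnbhs /within /= => k.
  apply: filterS k => z k _; rewrite /off.
  by case: eqVneq => [_|zy]; [exact: nbhs_singleton B0|exact: k].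
rewrite off_neq//; apply: cvg_trans (cont_on_setD1 _ _ _ hc _ Ax xy).
apply: near_eq_cvg; apply: cvg_within.
by apply: filterS (off_near y h x xy).
Qed.

Lemma open_measurable_borel U : open U -> measurable (U : set (borelType M)).
Proof. by move=> oU; exact: sub_sigma_algebra. Qed.

Lemma measurable_fun_continuous U f : open U ->
  (forall x, U x -> {for x, continuous f}) ->
  measurable_fun (U : set (borelType M)) f.
Proof.
move=> oU fc; apply: (measurability _ (RGenOInfty.measurableE R)).
move=> _ [_ [a ->] <-]; apply: open_measurable_borel.
rewrite openE => x [Ux fx]; apply: filterI; first exact: open_nbhs_nbhs.
by apply: fc => //; apply: open_nbhs_nbhs; split => //; exact: interval_open.
Qed.

End point_removal.

(** * Powers, logarithms and the two profiles *)

Section powers.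
Context {R : realType}.

Lemma powR_continuous (a s : R) : 0 < s -> {for s, continuous (fun t => t `^ a)}.
Proof.
move=> s0; apply: differentiable_continuous; apply/derivable1_diffP.
by have d := is_derive1_powR a s0; exact: ex_derive.
Qed.

Lemma powRB1 (a s : R) : 0 < s -> s `^ a = s `^ (a - 1) * s.
Proof.
by move=> s0; rewrite -{3}(powRr1 (ltW s0)) -powRD ?subrK// (gt_eqF s0) implybT.
Qed.

(** The logarithmic factor ln (R / d), with d = Gamma^c, as a function of the value s of [Gamma]. *)
Definition log_dist (r c s : R) : R := ln (r / s `^ c).

Lemma log_distE (r c s : R) : 0 < r -> 0 < s -> log_dist r c s = ln r - c * ln s.
Proof.
move=> r0 s0; rewrite /log_dist lnM ?posrE ?invr_gt0 ?powR_gt0//.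
by rewrite lnV ?posrE ?powR_gt0// ln_powR.
Qed.

Lemma log_dist_derive (r c s : R) : 0 < r -> 0 < s ->
  is_derive s 1 (log_dist r c) (- c / s).
Proof.
move=> r0 s0; have d := is_derive1_ln s0.
apply: (near_eq_is_derive (f := fun t => ln r - c * ln t)).
  near=> t; rewrite log_distE//; near: t; exact: lt_nbhsr.
by apply: is_derive_eq; rewrite add0r mul1r mulNr.
Unshelve. all: by end_near. Qed.

Lemma hardy_profile_derive (a s : R) : 0 < s ->
  is_derive s 1 (fun t => - (a / 2) * t `^ a) (- (a / 2) * (a * s `^ (a - 1))).
Proof.
by move=> s0; have d := is_derive1_powR a s0; apply: is_derive_eq.
Qed.

Lemma log_profile_derive (r a c s : R) : 0 < r -> 0 < s -> log_dist r c s != 0 ->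
  is_derive s 1
    (fun t => - (a / 2) * t `^ a + - (c / 2) * (t `^ a * (log_dist r c t)^-1))
    (- (a / 2) * (a * s `^ (a - 1)) + - (c / 2) *
      (s `^ a * (log_dist r c s ^- 2 * (c / s)) +
       (log_dist r c s)^-1 * (a * s `^ (a - 1)))).
Proof.
move=> r0 s0 L0; have d := is_derive1_powR a s0.
have dL := log_dist_derive r c s r0 s0; have dV := is_deriveV L0 dL.
apply: is_derive_eq; rewrite /GRing.scale /=; ring.
Qed.

(** For the weight s^(a+1) and phi = k s^a, the sum phi^2/W + phi' is (k^2 + a k) s^(a-1). It is
    least at k = -a/2, which leaves room for the constant a^2/4. *)
Lemma hardy_profile_eq (a s : R) : 0 < s ->
  (- (a / 2) * s `^ a) ^+ 2 / s `^ (a + 1) + - (a / 2) * (a * s `^ (a - 1)) +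
  a ^+ 2 / 4 * s `^ (a - 1) = 0.
Proof.
move=> s0; rewrite (powRB1 (a + 1))// addrK (powRB1 a)//.
have t0 : s `^ (a - 1) != 0 by rewrite gt_eqF// powR_gt0.
have sn0 : s != 0 by rewrite gt_eqF.
by field; rewrite sn0 t0.
Qed.

(** Replace k = -a/2 by -a/2 + q/L with L = ln (r/s^c), so L' = -c/s. The terms in 1/L cancel and
    (q^2 + c q)/L^2 is added to the coefficient of s^(a-1); it is least at q = -c/2, whence
    c^2/4. *)
Lemma log_profile_eq (r a c s : R) : 0 < s -> log_dist r c s != 0 ->
  (- (a / 2) * s `^ a + - (c / 2) * (s `^ a * (log_dist r c s)^-1)) ^+ 2 / s `^ (a + 1) +
  (- (a / 2) * (a * s `^ (a - 1)) + - (c / 2) *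
      (s `^ a * (log_dist r c s ^- 2 * (c / s)) +
       (log_dist r c s)^-1 * (a * s `^ (a - 1)))) +
  (a ^+ 2 / 4 + c ^+ 2 / 4 * log_dist r c s ^- 2) * s `^ (a - 1) = 0.
Proof.
move=> s0; move: (log_dist r c s) => L L0; rewrite (powRB1 (a + 1))// addrK (powRB1 a)//.
have t0 : s `^ (a - 1) != 0 by rewrite gt_eqF// powR_gt0.
have sn0 : s != 0 by rewrite gt_eqF.
by field; rewrite ?sn0 ?t0 ?L0.
Qed.

Lemma log_dist_inv_continuous (r c s : R) : 0 < r -> 0 < s ->
  log_dist r c s != 0 -> {for s, continuous (fun t => (log_dist r c t)^-1)}.
Proof.
move=> r0 s0 L0; apply: cvgV => //.
apply: differentiable_continuous; apply/derivable1_diffP.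
by have d := log_dist_derive r c s r0 s0; exact: ex_derive.
Qed.

Lemma log_profile_derive_continuous (r a c s : R) : 0 < r -> 0 < s ->
  log_dist r c s != 0 -> {for s, continuous (fun t =>
    - (a / 2) * (a * t `^ (a - 1)) + - (c / 2) *
      (t `^ a * (log_dist r c t ^- 2 * (c / t)) +
       (log_dist r c t)^-1 * (a * t `^ (a - 1))))}.
Proof.
move=> r0 s0 L0; have Lc := log_dist_inv_continuous r c s r0 s0 L0.
have ac e := powR_continuous e s s0.
have kc (k : R) (f : R -> R) : {for s, continuous f} ->
    {for s, continuous (fun t => k * f t)}.
  by move=> fc; apply: cvgM; [exact: cvg_cst|exact: fc].
have L2c : {for s, continuous (fun t => log_dist r c t ^- 2)}.
  rewrite (_ : (fun t => _) = (fun t => (log_dist r c t)^-1 * (log_dist r c t)^-1)).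
    by apply: cvgM; exact: Lc.
  by apply/funext => t; rewrite -exprVn expr2.
have Vc : {for s, continuous (fun t : R => c / t)}.
  by apply: kc; apply: inv_continuous; rewrite gt_eqF.
apply: cvgD; first by apply: (kc); exact: kc.
apply: (kc); apply: cvgD; apply: cvgM.
- exact: ac.
- by apply: cvgM; [exact: L2c|exact: Vc].
- exact: Lc.
- exact: kc.
Qed.

End powers.

(** * The weighted Hardy inequality with a pole at [y] *)

Section hardy.
Context {R : realType} {n N : nat} {M : smoothManifold R n.+1}.
Context {X : 'I_N -> vectorField M} {w : volumeForm M}.
Context {nu : {measure set (borelType M) -> \bar R}}.
Context {T : set M} {y : M} {Gamma : M -> R} {Omega : set M}.
Context {m : nat} {S : 'I_m -> boundaryPatch M}.
Hypothesis hGamma : positive_fundamental_solution X w nu T y Gamma.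
Hypothesis hOmega : strongly_admissible X w nu T y Gamma Omega S.
Hypothesis hy : ~ bdry Omega y.

Let fsGamma : fundamental_solution X w nu T y Gamma.
Proof. by case: hGamma. Qed.

Lemma Gamma_gt0 x : T x -> x != y -> 0 < Gamma x.
Proof. by move=> Tx /eqP xy; case: hGamma => _ + _; apply; split. Qed.

Lemma closure_sub_T x : closure Omega x -> T x.
Proof. exact: sadm_sub hOmega x. Qed.

Lemma Omega_open : open Omega.
Proof. exact: adm_open (sadm_admissible hOmega). Qed.

Lemma closure_compact : compact (closure Omega).
Proof. exact: adm_bounded (sadm_admissible hOmega). Qed.

Lemma Omega_sub_T x : Omega x -> T x.
Proof. by move=> Ox; apply/closure_sub_T/subset_closure. Qed.

Lemma Gamma_continuous x : T x -> x != y -> {for x, continuous Gamma}.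
Proof.
by move=> Tx /eqP xy; have [[+ _] _] := fs_C2 fsGamma; apply; split.
Qed.

Lemma is_Xder_Gamma k x : T x -> x != y ->
  is_Xder (X k) Gamma x (Xder (X k) Gamma x).
Proof.
move=> Tx /eqP xy; apply/is_XderP; split => //.
by have [[_ /(_ k)[+ _]] _] := fs_C2 fsGamma; apply; split.
Qed.

Lemma Xder_Gamma_continuous k x : T x -> x != y ->
  {for x, continuous (Xder (X k) Gamma)}.
Proof.
by move=> Tx /eqP xy; have [[_ /(_ k)[_ +]] _] := fs_C2 fsGamma; apply; split.
Qed.

Lemma near_T_neq : \forall x \near y^', T x /\ x != y.
Proof.
rewrite near_withinE; have := open_nbhs_nbhs (conj (fs_open fsGamma) (fs_mem fsGamma)).
by apply: filterS => x Tx xy; split.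
Qed.

Lemma Gamma_large (K : R) : \forall x \near y^', K <= Gamma x.
Proof.
case: hGamma => _ _ /cvgrPdist_lt h.
have K0 : 0 < (`|K| + 1)^-1 by rewrite invr_gt0 ltr_wpDl.
near=> x.
have [Tx xy] : T x /\ x != y by near: x; exact: near_T_neq.
have G0 := Gamma_gt0 x Tx xy.
have : `|0 - (Gamma x)^-1| < (`|K| + 1)^-1 by near: x; exact: h.
rewrite sub0r normrN gtr0_norm ?invr_gt0// ltf_pV2 ?posrE ?ltr_wpDl//.
by move=> /ltW; apply: le_trans; rewrite (le_trans (ler_norm _))// lerDl.
Unshelve. all: by end_near. Qed.

Lemma Gamma_comp_cont_on (A : set M) (D : set R) (H : R -> R) :
  (forall x, A x -> x != y -> T x /\ D (Gamma x)) ->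
  (forall s, D s -> {for s, continuous H}) ->
  cont_on (A `\ y) (fun x => H (Gamma x)).
Proof.
move=> AD Hc; apply: cont_on_for => x [Ax /eqP xy].
have [Tx Dx] := AD x Ax xy.
by apply: continuous_comp; [exact: Gamma_continuous|exact: Hc].
Qed.

Lemma Xder_Gamma_cont_on k (A : set M) : A `<=` T ->
  cont_on (A `\ y) (Xder (X k) Gamma).
Proof.
move=> AT; apply: cont_on_for => x [Ax /eqP xy].
by apply: Xder_Gamma_continuous => //; exact: AT.
Qed.

Lemma measurable_Omega : measurable (Omega `\ y : set (borelType M)).
Proof. by apply: open_measurable_borel; apply: open_setD1; exact: Omega_open. Qed.

(** Reset to 0 at the pole, 1/Gamma is continuous on the compact closure. *)
Lemma Gamma_inv_bounded : exists2 C : R, 0 < C &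
  forall x, closure Omega x -> x != y -> (Gamma x)^-1 <= C.
Proof.
have cT x : closure Omega x -> x != y -> T x /\ (fun s => 0 < s) (Gamma x).
  by move=> /closure_sub_T Tx xy; split => //; exact: Gamma_gt0.
have [|C C0 bC] := cont_on_bounded _ (off y (fun x => (Gamma x)^-1)) closure_compact.
  apply: off_cont_on; first by case: hGamma.
  apply: (Gamma_comp_cont_on _ (fun s => 0 < s) (fun s => s^-1) cT) => s s0.
  have : s != 0 by rewrite gt_eqF.
  exact: inv_continuous.
exists C => // x cx xy; have := bC x cx; rewrite off_neq//.
by apply: le_trans; exact: ler_norm.
Qed.

(* Gamma is locally integrable and bounded below by a positive constant. *)
Lemma nu_Omega_lt_pinfty : (nu (Omega `\ y) < +oo)%E.
Proof.
have [C C0 bC] := Gamma_inv_bounded.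
have mO := measurable_Omega.
have mc : measurable (closure Omega `\ y : set (borelType M)).
  apply: measurableD.
    rewrite -[X in measurable X]setCK; apply: measurableC; apply: open_measurable_borel.
    by rewrite openC; exact: closed_closure.
  rewrite -[X in measurable X]setCK; apply: measurableC; apply: open_measurable_borel.
  by have := open_setD1 setT y openT; rewrite setTD.
have GI : nu.-integrable (Omega `\ y) (EFin \o Gamma).
  apply: (integrableS mc) => //; last first.
    exact: (fs_locally_integrable fsGamma closure_compact (sadm_sub hOmega)).
  by apply: setSD; exact: subset_closure.
have /integrableP[_ ] := integrableZl mO C GI.
apply: le_lt_trans; rewrite -[nu _]mul1e -integral_cst//.
apply: ge0_le_integral => //.
- apply: measurableT_comp => //; apply: emeasurable_funM => //.
  exact: measurable_int GI.
- move=> x [Ox /eqP xy]; have Tx := Omega_sub_T _ Ox.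
  have h := bC x (subset_closure Ox) xy; have G0 := Gamma_gt0 x Tx xy.
  by rewrite /= lee_fin gtr0_norm ?mulr_gt0// -ler_pdivrMr// mul1r.
Qed.

(** * Profiles regular on a set [D] that contains the values of [Gamma] *)

Section truncated.
Variables (u : M -> R) (hu : C1X_bar X Omega u).
Variables (D : set R) (W : R -> R).
Hypothesis Gamma_D : forall x, closure Omega x -> x != y -> D (Gamma x).
Hypothesis W_gt0 : forall s, D s -> 0 < W s.
Hypothesis W_cont : forall s, D s -> {for s, continuous W}.

Lemma closure_D x : closure Omega x -> x != y -> T x /\ D (Gamma x).
Proof. by move=> cx xy; split; [exact: closure_sub_T|exact: Gamma_D]. Qed.

Lemma Omega_D x : Omega x -> x != y -> T x /\ D (Gamma x).
Proof. by move=> /subset_closure; exact: closure_D. Qed.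

Lemma u_cont_on : cont_on (closure Omega) u.
Proof. by apply/cont_onP; case: hu. Qed.

Lemma is_Xder_u k x : Omega x -> is_Xder (X k) u x (Xder (X k) u x).
Proof.
by move=> Ox; apply/is_XderP; split => //; have [[_ /(_ k)[+ _]] _] := hu; exact.
Qed.

Lemma Xder_u_cont_on k : cont_on Omega (Xder (X k) u).
Proof. by apply: cont_on_for; have [[_ /(_ k)[_ +]] _] := hu; exact. Qed.

Lemma u_cont_on_Omega : cont_on Omega u.
Proof. by apply: cont_on_for; have [[+ _] _] := hu; exact. Qed.

(** * Test functions that vanish near the pole *)

Section test_function.
Variables (F dF : R -> R) (K : R).
Hypothesis F_derive : forall s, D s -> is_derive s 1 F (dF s).
Hypothesis dF_cont : forall s, D s -> {for s, continuous dF}.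
Hypothesis F0 : forall s, K <= s -> F s = 0.
Hypothesis dF0 : forall s, K <= s -> dF s = 0.

(** Near the pole [Gamma] exceeds [K], where [F] is 0; with the value at [y] reset, the function
    vanishes on a full neighbourhood of [y], whatever [Gamma y] is. *)
Definition test_fun : M -> R := off y (fun x => F (Gamma x) * u x ^+ 2).

Definition Xtest_fun k : M -> R := off y (fun x =>
  F (Gamma x) * (2 * u x * Xder (X k) u x) +
  u x ^+ 2 * (dF (Gamma x) * Xder (X k) Gamma x)).

Lemma F_cont s : D s -> {for s, continuous F}.
Proof.
move=> Ds; apply: differentiable_continuous; apply/derivable1_diffP.
by have d := F_derive s Ds; exact: ex_derive.
Qed.

Lemma test_fun_cont_on : cont_on (closure Omega) test_fun.
Proof.
apply: off_cont_on.
  apply: cvg_dnbhs_near0; apply: filterS (Gamma_large K) => x /F0 ->.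
  by rewrite mul0r.
apply: cont_onM; first exact: Gamma_comp_cont_on closure_D F_cont.
by apply: cont_onM; apply: cont_on_sub u_cont_on => x [].
Qed.

Lemma is_Xder_test_fun k x : Omega x -> is_Xder (X k) test_fun x (Xtest_fun k x).
Proof.
move=> Ox; have [->|xy] := eqVneq x y.
  apply: (is_Xder_near _ (fun=> 0)).
    have h : \forall x \near y^', F (Gamma x) * u x ^+ 2 = 0.
      by apply: filterS (Gamma_large K) => z /F0 ->; rewrite mul0r.
    by apply: filterS (off_near0 _ _ h) => z; rewrite /test_fun => ->.
  by rewrite /Xtest_fun /off eqxx; exact: is_Xder_cst.
have [Tx Dx] := Omega_D _ Ox xy.
apply: (is_Xder_near _ (fun x => F (Gamma x) * (u x * u x))).
  apply: filterS (off_near y (fun x => F (Gamma x) * u x ^+ 2) x xy) => z.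
  by rewrite /test_fun expr2.
rewrite /Xtest_fun off_neq//.
have du := is_Xder_u k x Ox.
have h := is_XderM _ _ _ _ _ _
  (is_Xder_comp _ _ _ _ _ _ (F_derive _ Dx) (is_Xder_Gamma k x Tx xy))
  (is_XderM _ _ _ _ _ _ du du).
by apply: (eq_rect _ (is_Xder (X k) _ x) h); rewrite /=; ring.
Qed.

Lemma Xtest_fun_cont_on k : cont_on Omega (Xtest_fun k).
Proof.
apply: off_cont_on.
  apply: cvg_dnbhs_near0; apply: filterS (Gamma_large K) => x Kx.
  by rewrite F0// dF0// !mul0r mulr0 addr0.
have uc : cont_on (Omega `\ y) u by apply: cont_on_sub u_cont_on_Omega => x [].
apply: cont_onD; apply: cont_onM.
- exact: Gamma_comp_cont_on Omega_D F_cont.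
- apply: cont_onM; first by apply: cont_onM => //; exact: cont_on_cst.
  by apply: cont_on_sub (Xder_u_cont_on k) => x [].
- by apply: cont_onM.
- apply: cont_onM; first exact: Gamma_comp_cont_on Omega_D dF_cont.
  by apply: Xder_Gamma_cont_on => x; exact: Omega_sub_T.
Qed.

Lemma Xder_test_fun k x : Omega x -> Xder (X k) test_fun x = Xtest_fun k x.
Proof. by move=> /(is_Xder_test_fun k)/is_XderP[]. Qed.

Lemma test_fun_C1X_bar : C1X_bar X Omega test_fun.
Proof.
have OO x : Omega x -> nbhs x Omega.
  by move=> Ox; apply: open_nbhs_nbhs; split => //; exact: Omega_open.
split; last exact/cont_onP/test_fun_cont_on.
split=> [x Ox|k].
  apply: (cont_on_nbhs (closure Omega)); last exact: test_fun_cont_on.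
  by apply: filterS (OO x Ox); exact: subset_closure.
split=> x Ox; first by have /is_XderP[] := is_Xder_test_fun k x Ox.
apply: (cont_on_nbhs Omega); first exact: OO.
by apply: cont_on_eq (Xtest_fun_cont_on k) => z /(Xder_test_fun k).
Qed.

Lemma measurable_cont_on (f : M -> R) : cont_on (Omega `\ y) f ->
  measurable_fun (Omega `\ y : set (borelType M)) f.
Proof.
have oO : open (Omega `\ y) by apply: open_setD1; exact: Omega_open.
move=> fc; apply: measurable_fun_continuous => // x Ox.
by apply: cont_on_nbhs fc; exact: open_nbhs_nbhs.
Qed.

Lemma density_measurable (P : R -> R) : (forall s, D s -> {for s, continuous P}) ->
  measurable_fun (Omega `\ y : set (borelType M))
    (fun x => P (Gamma x) * grad_sq X Gamma x * u x ^+ 2).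
Proof.
move=> Pc; apply: measurable_cont_on; apply: cont_onM.
  apply: cont_onM; first exact: Gamma_comp_cont_on Omega_D Pc.
  apply: cont_on_sum => k.
  by apply: cont_onM; apply: Xder_Gamma_cont_on => x; exact: Omega_sub_T.
by apply: cont_onM; apply: cont_on_sub u_cont_on_Omega => x [].
Qed.

Lemma density_ge0 (P : R -> R) x : (forall s, D s -> 0 <= P s) ->
  (Omega `\ y) x -> 0 <= P (Gamma x) * grad_sq X Gamma x * u x ^+ 2.
Proof.
move=> P0 [Ox /eqP xy]; have [_ Dx] := Omega_D _ Ox xy.
rewrite mulr_ge0 ?sqr_ge0// mulr_ge0 ?P0//.
by apply: sumr_ge0 => k _; exact: sqr_ge0.
Qed.

Lemma integral_densityZ (k : R) (P : R -> R) : 0 <= k ->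
  (forall s, D s -> {for s, continuous P}) -> (forall s, D s -> 0 <= P s) ->
  (k%:E * \int[nu]_(x in Omega `\ y)
     (P (Gamma x) * grad_sq X Gamma x * u x ^+ 2)%:E =
   \int[nu]_(x in Omega `\ y)
     (k * P (Gamma x) * grad_sq X Gamma x * u x ^+ 2)%:E)%E.
Proof.
move=> k0 Pc P0; rewrite -ge0_integralZl_EFin//.
- by apply: eq_integral => x _; rewrite -EFinM !mulrA.
- exact: measurable_Omega.
- by move=> x Ox; rewrite lee_fin density_ge0.
- by apply/measurable_EFinP; exact: density_measurable.
Qed.

Lemma integral_densityD (P Q : R -> R) :
  (forall s, D s -> {for s, continuous P}) -> (forall s, D s -> 0 <= P s) ->
  (forall s, D s -> {for s, continuous Q}) -> (forall s, D s -> 0 <= Q s) ->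
  (\int[nu]_(x in Omega `\ y)
     (P (Gamma x) * grad_sq X Gamma x * u x ^+ 2)%:E +
   \int[nu]_(x in Omega `\ y)
     (Q (Gamma x) * grad_sq X Gamma x * u x ^+ 2)%:E =
   \int[nu]_(x in Omega `\ y)
     ((P (Gamma x) + Q (Gamma x)) * grad_sq X Gamma x * u x ^+ 2)%:E)%E.
Proof.
move=> Pc P0 Qc Q0; rewrite -ge0_integralD//.
- by apply: eq_integral => x _; rewrite -EFinD !mulrDl.
- exact: measurable_Omega.
- by move=> x Ox; rewrite lee_fin density_ge0.
- by apply/measurable_EFinP; exact: density_measurable.
- by move=> x Ox; rewrite lee_fin density_ge0.
- by apply/measurable_EFinP; exact: density_measurable.
Qed.

Lemma W_grad_u_cont_on :
  cont_on (Omega `\ y) (fun x => W (Gamma x) * grad_sq X u x).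
Proof.
apply: cont_onM; first exact: Gamma_comp_cont_on Omega_D W_cont.
apply: cont_on_sum => k; have c : cont_on (Omega `\ y) (Xder (X k) u).
  by apply: cont_on_sub (Xder_u_cont_on k) => x [].
exact: cont_onM.
Qed.

(** These are the terms of the test integrand free of [X_k u], after Young's inequality. They extend
    continuously to the compact closure because [F] and [dF] vanish near the pole. *)
Lemma F_Gamma_bounded k : exists C : R, forall x, (Omega `\ y) x ->
  ((F (Gamma x) ^+ 2 / W (Gamma x) + `|dF (Gamma x)|) *
    (u x * Xder (X k) Gamma x) ^+ 2) <= C.
Proof.
pose h x := ((F (Gamma x) ^+ 2 / W (Gamma x) + `|dF (Gamma x)|) *
    (u x * Xder (X k) Gamma x) ^+ 2).
have [|C C0 hC] := cont_on_bounded _ (off y h) closure_compact.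
  apply: off_cont_on.
    apply: cvg_dnbhs_near0; apply: filterS (Gamma_large K) => x Kx.
    by rewrite /h F0// dF0// normr0 expr0n mul0r addr0 mul0r.
  have gc : cont_on (closure Omega `\ y) (fun x => u x * Xder (X k) Gamma x).
    apply: cont_onM; first by apply: cont_on_sub u_cont_on => x [].
    by apply: Xder_Gamma_cont_on; exact: closure_sub_T.
  apply: cont_onM; last exact: cont_onM.
  apply: (Gamma_comp_cont_on _ _ (fun s => F s ^+ 2 / W s + `|dF s|) closure_D) => s Ds.
  have Fc := F_cont s Ds; have dFc := dF_cont s Ds; have Wc := W_cont s Ds.
  have W0 : W s != 0 by rewrite gt_eqF ?W_gt0.
  apply: cvgD; last exact: cvg_norm dFc.
  by apply: cvgM; [exact: cvgM|exact: cvgV].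
exists C => x [Ox /eqP xy]; have := hC x (subset_closure Ox).
by rewrite off_neq//; apply: le_trans; exact: ler_norm.
Qed.

Lemma young_weighted (s a b v : R) : D s ->
  2 * `|F s * v * a * b| <= W s * a ^+ 2 + F s ^+ 2 / W s * (v * b) ^+ 2.
Proof.
move=> Ds; have W0 := W_gt0 s Ds.
have h e : 0 <= (W s * a + e) ^+ 2 / W s by rewrite divr_ge0 ?sqr_ge0// ltW.
have Wn0 : W s != 0 by rewrite gt_eqF.
(* [(W a +- F v b)^2 / W >= 0] *)
rewrite -(ger0_norm (_ : 0 <= 2 :> R))// -normrM ler_norml; apply/andP; split.
- rewrite -subr_ge0; have := h (F s * v * b); congr (0 <= _); by field.
- rewrite -subr_ge0; have := h (- (F s * v * b)); congr (0 <= _); by field.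
Qed.

Lemma Xtest_fun_Gamma_cont_on k :
  cont_on (Omega `\ y) (fun x => Xder (X k) test_fun x * Xder (X k) Gamma x).
Proof.
apply: cont_onM; last by apply: Xder_Gamma_cont_on => x; exact: Omega_sub_T.
apply: cont_on_eq (cont_on_sub (Omega `\ y) Omega _ _ (Xtest_fun_cont_on k)).
  by move=> x [/(Xder_test_fun k) -> _].
by move=> x [].
Qed.

(** Young's inequality splits the integrand into a part below the weighted gradient of [u], which
    absorbs a possible blow-up of [X_k u] at the boundary, and a bounded part, integrable since [nu]
    is finite on the domain. *)
Lemma Xtest_fun_integrable k :
  nu.-integrable (Omega `\ y) (EFin \o (fun x => W (Gamma x) * grad_sq X u x)) ->
  nu.-integrable (Omega `\ y)
    (EFin \o (fun x => Xder (X k) test_fun x * Xder (X k) Gamma x)).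
Proof.
move=> WI; have mO := measurable_Omega.
have [C hC] := F_Gamma_bounded k.
have CI : nu.-integrable (Omega `\ y) (EFin \o (fun=> C)).
  apply: measurable_bounded_integrable => //; first exact: nu_Omega_lt_pinfty.
  by exists `|C|; split; rewrite ?num_real// => x Cx t _; exact: ltW.
apply: (le_integrable mO _ _ (integrableD mO WI CI)).
  by apply/measurable_EFinP; apply: measurable_cont_on; exact: Xtest_fun_Gamma_cont_on.
move=> x Ox; have := hC x Ox; case: Ox => Ox /eqP xy Cx.
have [Tx Dx] := Omega_D _ Ox xy.
rewrite /= lee_fin; apply: le_trans (ler_norm _).
rewrite Xder_test_fun// /Xtest_fun off_neq//.
set a := Xder (X k) u x; set b := Xder (X k) Gamma x in Cx *.
have Y := young_weighted (Gamma x) a b (u x) Dx.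
have ag : W (Gamma x) * a ^+ 2 <= W (Gamma x) * grad_sq X u x.
  rewrite ler_wpM2l ?(ltW (W_gt0 _ Dx))// /grad_sq (bigD1 k)//= lerDl.
  by rewrite sumr_ge0// => i _; exact: sqr_ge0.
apply: le_trans (_ : 2 * `|F (Gamma x) * u x * a * b| +
    `|dF (Gamma x)| * (u x * b) ^+ 2 <= _).
  rewrite mulrDl; apply: le_trans (ler_normD _ _) _; apply: lerD.
    rewrite (_ : F (Gamma x) * _ * b = 2 * (F (Gamma x) * u x * a * b)); last by ring.
    by rewrite normrM ger0_norm.
  rewrite (_ : u x ^+ 2 * _ * b = dF (Gamma x) * (u x * b) ^+ 2); last by ring.
  by rewrite normrM (ger0_norm (sqr_ge0 _)).
apply: le_trans (lerD Y (lexx _)) _.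
by rewrite -addrA -mulrDl lerD.
Qed.

Lemma flux_test_fun :
  nu.-integrable (Omega `\ y) (EFin \o (fun x => W (Gamma x) * grad_sq X u x)) ->
  \int[nu]_(x in Omega `\ y) grad_dot X test_fun Gamma x =
  flux w S (fun i x => (F (Gamma x) * u x ^+ 2) *: grad_field X Gamma i x).
Proof.
move=> WI; have := sadm_divergence hOmega test_fun_C1X_bar
  (fun k => Xtest_fun_integrable k WI).
(* The Dirac term disappears because the test function is 0 at [y]. *)
rewrite {2}/test_fun /off eqxx mulr0 subr0 => ->.
have pb := adm_boundary (sadm_admissible hOmega).
have bc x : bdry Omega x -> closure Omega x by case.
pose V k (i : chart_index M) (x : M) :=
  (test_fun x * Xder (X k) Gamma x) *: Defs.comp (X k) i x.
have Vr k : flux_regular w S (V k).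
  apply: (flux_regular_field w pb).
  apply: cont_onM; first exact: cont_on_sub test_fun_cont_on.
  apply: cont_on_sub (Xder_Gamma_cont_on k _ closure_sub_T) => x bx.
  split; first exact: bc.
  by move=> /= xy; apply: hy; rewrite -xy.
have [_ <-] := flux_sum w S 'I_N (index_enum 'I_N) V Vr.
apply: (eq_flux w pb) => i x bx; have xy : x != y.
  by apply/eqP => xy; apply: hy; rewrite -xy.
rewrite /grad_field scaler_sumr; apply: eq_bigr => k _.
by rewrite /V /test_fun off_neq// scalerA.
Qed.

Lemma truncated_hardy (Q : R -> R) :
  (forall s, D s -> {for s, continuous Q}) ->
  (forall s, D s -> 0 <= Q s) ->
  (forall s, D s -> F s ^+ 2 / W s + dF s + Q s <= 0) ->
  (\int[nu]_(x in Omega `\ y)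
      (Q (Gamma x) * grad_sq X Gamma x * u x ^+ 2)%:E +
   (flux w S (fun i x => (F (Gamma x) * u x ^+ 2) *: grad_field X Gamma i x))%:E
   <= \int[nu]_(x in Omega `\ y) (W (Gamma x) * grad_sq X u x)%:E)%E.
Proof.
move=> Qc Q0 FQ; have mO := measurable_Omega.
have gs0 (f : M -> R) x : 0 <= grad_sq X f x by apply: sumr_ge0 => k _; exact: sqr_ge0.
have W0 x : (Omega `\ y) x -> (0 <= (W (Gamma x) * grad_sq X u x)%:E)%E.
  move=> [Ox /eqP xy]; rewrite lee_fin mulr_ge0// ltW// W_gt0//.
  by have [] := Omega_D _ Ox xy.
(* An infinite right-hand side is trivial; a finite one provides the integrability needed by the
   divergence identity. *)
have [->|Wfin] := eqVneq
    (\int[nu]_(x in Omega `\ y) (W (Gamma x) * grad_sq X u x)%:E)%E +oo%E.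
  exact: leey.
have WI : nu.-integrable (Omega `\ y) (EFin \o (fun x => W (Gamma x) * grad_sq X u x)).
  apply/integrableP; split.
    by apply/measurable_EFinP; apply: measurable_cont_on; exact: W_grad_u_cont_on.
  under eq_integral => x /set_mem Ox do rewrite gee0_abs ?W0//.
  by rewrite ltey.
have GI : nu.-integrable (Omega `\ y) (EFin \o grad_dot X test_fun Gamma).
  rewrite (_ : EFin \o _ = (fun x => (\sum_(k < N)
      (Xder (X k) test_fun x * Xder (X k) Gamma x)%R%:E)%E)).
    by apply: integrable_sum => // k _; exact: Xtest_fun_integrable.
  by apply/funext => x; rewrite sumEFin.
have mQ := density_measurable Q Qc.
have pw x : (Omega `\ y) x -> Q (Gamma x) * grad_sq X Gamma x * u x ^+ 2 +
    grad_dot X test_fun Gamma x <= W (Gamma x) * grad_sq X u x.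
  move=> [Ox /eqP xy]; have [Tx Dx] := Omega_D _ Ox xy.
  rewrite /grad_sq /grad_dot !mulr_sumr mulr_suml -big_split /=.
  apply: ler_sum => k _; rewrite Xder_test_fun// /Xtest_fun off_neq//.
  set a := Xder (X k) u x; set b := Xder (X k) Gamma x.
  have Y := young_weighted (Gamma x) a b (u x) Dx.
  have FQx : F (Gamma x) ^+ 2 / W (Gamma x) * (u x * b) ^+ 2 <=
      - (dF (Gamma x) + Q (Gamma x)) * (u x * b) ^+ 2.
    by rewrite ler_wpM2r ?sqr_ge0// -subr_le0 opprK addrA FQ.
  rewrite [leLHS](_ : _ = 2 * (F (Gamma x) * u x * a * b) +
    (dF (Gamma x) + Q (Gamma x)) * (u x * b) ^+ 2); last by ring.
  rewrite -lerBrDr -mulNr; apply: le_trans (_ : 2 * `|F (Gamma x) * u x * a * b| <= _).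
    by rewrite ler_wpM2l// ler_norm.
  by apply: le_trans Y _; rewrite lerD2l.
(* The integral of the [Q] term is not yet known to be finite, so the finite gradient term is moved
   to the right and two nonnegative integrands are compared. *)
rewrite -flux_test_fun// -leeBrDr//.
rewrite /Rintegral fineK; last exact: integrable_fin_num.
rewrite -integralB//.
apply: ge0_le_integral => //.
- by move=> x Ox; rewrite lee_fin density_ge0.
- exact/measurable_EFinP.
- by apply: emeasurable_funB; [exact: measurable_int WI|exact: measurable_int GI].
- by move=> x Ox; rewrite -EFinB lee_fin lerBrDr pw.
Qed.
End test_function.

(** The compact boundary avoids the pole. Hence cutoffs of large index are 1 on it and the flux does
    not change as they are removed. *)
Lemma Gamma_bdry_bounded : exists n0, forall x, bdry Omega x -> Gamma x <= n0%:R.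
Proof.
have bc : compact (bdry Omega).
  apply: subclosed_compact closure_compact _; last by move=> x [].
  rewrite /bdry setDE; apply: closedI; first exact: closed_closure.
  by apply: open_closedC; exact: open_interior.
have bG : cont_on (bdry Omega) Gamma.
  apply: cont_on_for => x bx; apply: Gamma_continuous.
    by apply: closure_sub_T; case: bx.
  by apply/eqP => xy; apply: hy; rewrite -xy.
have [C C0 hC] := cont_on_bounded _ _ bc bG.
exists (Num.truncn C).+1 => x bx; apply: le_trans (ler_norm _) (le_trans (hC x bx) _).
by apply: ltW; exact: truncnS_gt.
Qed.

Lemma weighted_hardy (phi dphi P : R -> R) :
  (forall s, D s -> is_derive s 1 phi (dphi s)) ->
  (forall s, D s -> {for s, continuous dphi}) ->
  (forall s, D s -> {for s, continuous P}) ->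
  (forall s, D s -> 0 <= phi s) ->
  (forall s, D s -> 0 <= P s) ->
  (forall s, D s -> phi s ^+ 2 / W s + dphi s + P s <= 0) ->
  (\int[nu]_(x in Omega `\ y)
      (P (Gamma x) * grad_sq X Gamma x * u x ^+ 2)%:E +
   (flux w S (fun i x => (phi (Gamma x) * u x ^+ 2) *: grad_field X Gamma i x))%:E
   <= \int[nu]_(x in Omega `\ y) (W (Gamma x) * grad_sq X u x)%:E)%E.
Proof.
move=> phiD dphic Pc phi0 P0 ineq.
have phic s : D s -> {for s, continuous phi}.
  move=> Ds; apply: differentiable_continuous; apply/derivable1_diffP.
  by have d := phiD s Ds; exact: ex_derive.
have cc p : continuous (cutoff p : R -> R).
  move=> s; apply: differentiable_continuous; apply/derivable1_diffP.
  by have d := cutoff_derive p s; exact: ex_derive.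
set L := (\int[nu]_(x in _) (W _ * _)%:E)%E.
set fl := flux _ _ _.
have [n0 hn0] := Gamma_bdry_bounded.
pose g p (x : M) := (cutoff p (Gamma x) * P (Gamma x) * grad_sq X Gamma x * u x ^+ 2)%:E.
have gL p : (n0 <= p)%N -> (\int[nu]_(x in Omega `\ y) g p x <= L - fl%:E)%E.
  move=> n0n; rewrite leeBrDr//.
  have -> : fl = flux w S (fun i x => (cutoff p (Gamma x) * phi (Gamma x) * u x ^+ 2)
       *: grad_field X Gamma i x).
    apply: (eq_flux w (adm_boundary (sadm_admissible hOmega))) => i x bx.
    by rewrite cutoff1 ?mul1r// (le_trans (hn0 x bx))// ler_nat.
  apply: (truncated_hardy (fun s => cutoff p s * phi s)
    (fun s => dcutoff p s * phi s + cutoff p s * dphi s) p.+1%:R _ _ _ _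
    (fun s => cutoff p s * P s)).
  - move=> s Ds; have d1 := cutoff_derive p s; have d2 := phiD s Ds.
    by apply: is_derive_eq; rewrite addrC; congr (_ + _); exact: mulrC.
  - move=> s Ds; apply: cvgD; apply: cvgM.
    + exact: dcutoff_continuous.
    + exact: phic.
    + exact: cc.
    + exact: dphic.
  - by move=> s ns; rewrite cutoff0// mul0r.
  - by move=> s ns; rewrite cutoff0// mul0r addr0 dcutoff0// mul0r.
  - by move=> s Ds; apply: cvgM; [exact: cc|exact: Pc].
  - by move=> s Ds; rewrite mulr_ge0 ?cutoff_ge0 ?P0.
  (* The truncated expression is at most the cutoff times the original one: the square of the cutoff
     is below the cutoff, and [dcutoff p s * phi s <= 0]. *)
  - move=> s Ds.
    apply: le_trans (_ : cutoff p s * (phi s ^+ 2 / W s + dphi s + P s) <= 0); last first.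
      by rewrite mulr_ge0_le0 ?cutoff_ge0 ?ineq.
    rewrite !mulrDr addrA !lerD2r.
    rewrite -[leRHS]addr0; apply: lerD; last first.
      by rewrite mulr_le0_ge0 ?dcutoff_le0 ?phi0.
    rewrite exprMn -mulrA ler_wpM2r//.
      by rewrite divr_ge0 ?sqr_ge0// ltW// W_gt0.
    by rewrite expr2 ler_piMr ?cutoff_ge0 ?cutoff_le1.
rewrite -leeBrDr//.
(* Pointwise the sequence is eventually constant: the cutoff is 1 at [Gamma x] once p >=
   [Gamma x]. *)
have gP x : g p x @[p --> \oo] --> (P (Gamma x) * grad_sq X Gamma x * u x ^+ 2)%:E.
  apply: cvg_near_cst; near=> p; rewrite /g cutoff1 ?mul1r//.
  near: p; exists (Num.truncn (Gamma x)).+1 => // k /= xk.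
  by apply: le_trans (ltW (truncnS_gt _)) _; rewrite ler_nat.
have gm p : measurable_fun (Omega `\ y : set (borelType M)) (g p).
  apply/measurable_EFinP; apply: (density_measurable (fun s => cutoff p s * P s)) => s Ds.
  by apply: cvgM; [exact: cc|exact: Pc].
have PG0 x := density_ge0 P x P0.
have g0 p x : (Omega `\ y) x -> (0 <= g p x)%E.
  by move=> /PG0 h; rewrite lee_fin -mulrA -mulrA mulr_ge0 ?cutoff_ge0// mulrA.
have gh x : (Omega `\ y) x -> {homo g^~ x : a b / (a <= b)%N >-> (a <= b)%E}.
  move=> /PG0 h a b ab; rewrite lee_fin -mulrA -mulrA -[leRHS]mulrA -[leRHS]mulrA.
  by rewrite ler_wpM2r ?cutoff_homo// mulrA.
have cg := cvg_monotone_convergence measurable_Omega gm g0 gh (mu := nu).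
have E : (\int[nu]_(x in Omega `\ y) limn (g^~ x) = \int[nu]_(x in Omega `\ y)
    (P (Gamma x) * grad_sq X Gamma x * u x ^+ 2)%:E)%E.
  by apply: eq_integral => x _; exact: cvg_lim (gP x).
rewrite -E -(cvg_lim _ cg)//; apply: lime_le; first by apply/cvg_ex; eexists; exact: cg.
by near=> p; apply: gL; near: p; exists n0.
Unshelve. all: by end_near. Qed.

End truncated.

(** The flux of the logarithmic profile has to be separated into the two boundary terms of the
    second inequality. *)
Lemma flux_grad_lin (a b : R) (f g : M -> R) :
  cont_on (bdry Omega) f -> cont_on (bdry Omega) g ->
  flux w S (fun i x => (a * f x + b * g x) *: grad_field X Gamma i x) =
  a * flux w S (fun i x => f x *: grad_field X Gamma i x) +
  b * flux w S (fun i x => g x *: grad_field X Gamma i x).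
Proof.
have pb := adm_boundary (sadm_admissible hOmega).
have reg (h : M -> R) : cont_on (bdry Omega) h ->
    flux_regular w S (fun i x => h x *: grad_field X Gamma i x).
  move=> hc; have -> : (fun i x => h x *: grad_field X Gamma i x) =
      (fun i x => \sum_(k < N) (h x * Xder (X k) Gamma x) *: Defs.comp (X k) i x).
    apply/funext => i; apply/funext => x; rewrite /grad_field scaler_sumr.
    by apply: eq_bigr => k _; rewrite scalerA.
  have Vr k : flux_regular w S
      (fun i x => (h x * Xder (X k) Gamma x) *: Defs.comp (X k) i x).
    apply: (flux_regular_field w pb); apply: cont_onM => //.
    apply: cont_on_sub (Xder_Gamma_cont_on k _ closure_sub_T) => x bx.
    split; first by case: bx.
    by move=> /= xy; apply: hy; rewrite -xy.
  by have [+ _] := flux_sum w S 'I_N (index_enum 'I_N) _ Vr.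
move=> /reg fr /reg gr.
(* [flux_lin] scales only its first field, so b g is split as (b - 1) g + g. *)
have -> : (fun i x => (a * f x + b * g x) *: grad_field X Gamma i x) =
    (fun i x => a *: (f x *: grad_field X Gamma i x) +
      ((b - 1) *: (g x *: grad_field X Gamma i x) + g x *: grad_field X Gamma i x)).
  apply/funext => i; apply/funext => x; rewrite !scalerA -!scalerDl; congr (_ *: _); ring.
rewrite flux_lin//; last exact: flux_regular_lin.
by rewrite flux_lin//; ring.
Qed.

(** The supremum runs over the open domain only; continuity carries the bound to the boundary, since
    a point violating it would have violating points of the domain nearby. *)
Lemma dist_le_sup (c : R) x : c < 0 -> closure Omega x -> x != y ->
  Gamma x `^ c <= sup [set Gamma z `^ c | z in Omega `\ y].
Proof.
move=> c0 cx xy.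
have [C C0 hC] := Gamma_inv_bounded.
have ub z : (Omega `\ y) z ->
    Gamma z `^ c <= sup [set Gamma z `^ c | z in Omega `\ y].
  move=> Oz; apply: sup_upper_bound; last by exists z.
  split; first by exists (Gamma z `^ c); exists z.
  (* As c < 0 and [Gamma] >= 1/C, the power Gamma^c is at most (1/C)^c. *)
  exists ((C^-1 `^ (- c))^-1) => _ [t [Ot /eqP ty] <-].
  have Gt0 := Gamma_gt0 t (Omega_sub_T _ Ot) ty.
  have Ct : C^-1 <= Gamma t.
    by rewrite -[leRHS]invrK lef_pV2 ?posrE ?invr_gt0// hC//; exact: subset_closure.
  have -> : Gamma t `^ c = (Gamma t `^ (- c))^-1 by rewrite -powRN opprK.
  rewrite lef_pV2 ?posrE ?powR_gt0 ?invr_gt0//.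
  by apply: ge0_ler_powR; rewrite ?nnegrE ?invr_ge0 ?oppr_ge0// ltW.
rewrite leNgt; apply/negP => lt_d.
have dc : {for x, continuous (fun z => Gamma z `^ c)}.
  apply: (continuous_comp (f := Gamma) (g := fun s => s `^ c)).
    by apply: Gamma_continuous => //; exact: closure_sub_T.
  by apply: powR_continuous; apply: Gamma_gt0 => //; exact: closure_sub_T.
have near_lt : \forall z \near x, sup [set Gamma z `^ c | z in Omega `\ y] < Gamma z `^ c.
  exact: dc _ (lt_nbhsr lt_d).
have [z [Oz [zlt zy]]] := cx _ (filterI near_lt (nbhs_neq x y xy)).
by have := ub z (conj Oz (elimN eqP zy)); rewrite leNgt zlt.
Qed.

(** The factor e in the bound gives r / Gamma^c >= e > 1, up to the boundary. *)
Lemma log_dist_gt0 (r c : R) x : c < 0 ->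
  expR 1 * sup [set Gamma z `^ c | z in Omega `\ y] <= r ->
  closure Omega x -> x != y -> 0 < r /\ 0 < log_dist r c (Gamma x).
Proof.
move=> c0 hr cx xy; have d0 : 0 < Gamma x `^ c.
  by rewrite powR_gt0// Gamma_gt0//; exact: closure_sub_T.
have dr : expR 1 * Gamma x `^ c <= r.
  by apply: le_trans hr; rewrite ler_wpM2l ?expR_ge0// dist_le_sup.
split; first by apply: lt_le_trans dr; rewrite mulr_gt0 ?expR_gt0.
rewrite /log_dist -ler_pdivlMr// in dr *.
by apply: ln_gt0; apply: lt_le_trans dr; rewrite expR_gt1.
Qed.

End hardy.

(** * The two inequalities, from the two profiles *)

Theorem theorem3p1 (R : realType) (n N : nat) (hN : (N <= n.+1)%N)
    (M : smoothManifold R n.+1) (w : volumeForm M)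
    (nu : {measure set (borelType M) -> \bar R}) (hnu : volume_measure w nu)
    (X : 'I_N -> vectorField M)
    (y : M) (T : set M) (Gamma : M -> R)
    (hGamma : positive_fundamental_solution X w nu T y Gamma)
    (Omega : set M) (m : nat) (S : 'I_m -> boundaryPatch M)
    (hOmega : strongly_admissible X w nu T y Gamma Omega S)
    (hy : ~ bdry Omega y)
    (alpha beta r : R) (halpha : 2 - beta < alpha) (hbeta : 2 < beta)
    (hr : expR 1 * sup [set Gamma x `^ (2 - beta)^-1 | x in Omega `\ y] <= r)
    (u : M -> R) (hu : C1X_bar X Omega u) :
  let d : M -> R := fun x => Gamma x `^ (2 - beta)^-1 in
  let lhs : \bar R := (\int[nu]_(x in Omega `\ y)
      (Gamma x `^ (alpha / (2 - beta)) * grad_sq X u x)%:E)%E in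
  let hardy : \bar R := ((((beta + alpha - 2) / 2) ^+ 2)%:E *
    \int[nu]_(x in Omega `\ y)
      (Gamma x `^ ((alpha - 2) / (2 - beta)) * grad_sq X d x *
       `|u x| ^+ 2)%:E)%E in
  let hardy_bdry : R := (beta + alpha - 2) / (2 * (beta - 2)) *
    flux w S (fun i x =>
      (Gamma x `^ (alpha / (2 - beta) - 1) * `|u x| ^+ 2) *:
      grad_field X Gamma i x) in
  let log_term : \bar R := ((4^-1)%:E *
    \int[nu]_(x in Omega `\ y)
      (Gamma x `^ ((alpha - 2) / (2 - beta)) * grad_sq X d x *
       (ln (r / d x)) ^- 2 * `|u x| ^+ 2)%:E)%E in
  let log_bdry : R := 1 / (2 * (beta - 2)) *
    flux w S (fun i x =>
      (Gamma x `^ (alpha / (2 - beta) - 1) * (ln (r / d x))^-1 *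
       `|u x| ^+ 2) *: grad_field X Gamma i x) in
  (hardy + hardy_bdry%:E <= lhs)%E /\
  (hardy + log_term + log_bdry%:E + hardy_bdry%:E <= lhs)%E.
Proof.
move=> d lhs hardy hardy_bdry log_term log_bdry.
have pos_fs : fundamental_solution X w nu T y Gamma by case: hGamma.
pose c := (2 - beta)^-1; pose a := alpha / (2 - beta) - 1.
have kap0 : 2 - beta != 0 by rewrite lt_eqF// subr_lt0.
have c0 : c < 0 by rewrite invr_lt0 subr_lt0.
(* This identity gives the sign of [a] and converts the constants of the statement: since c =
   -1/(beta - 2), the boundary coefficients become -a/2 and -c/2. *)
have aE : a = (beta + alpha - 2) * c by rewrite /a /c; field.
have gam0 : 0 < beta + alpha - 2 by lra.
have a0 : a < 0 by rewrite aE pmulr_rlt0.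
have WE s : s `^ (alpha / (2 - beta)) = s `^ (a + 1) by rewrite subrK.
have G0 x : closure Omega x -> x != y -> 0 < Gamma x.
  by move=> cx; apply: (Gamma_gt0 hGamma); exact: (closure_sub_T hOmega).
(* On this set both profiles are C^1 and nonnegative, so it serves for both inequalities. *)
pose D := [set s : R | 0 < s /\ (0 < r /\ 0 < log_dist r c s)].
have GD x : closure Omega x -> x != y -> D (Gamma x).
  move=> cx xy; split; first exact: G0.
  exact: (log_dist_gt0 hGamma hOmega r c x c0 hr cx xy).
have DL s : D s -> log_dist r c s != 0 by move=> [_ [_ L0]]; rewrite gt_eqF.
have W0 s : D s -> 0 < s `^ (alpha / (2 - beta)) by move=> [s0 _]; exact: powR_gt0.
have Wc s : D s -> {for s, continuous (fun t => t `^ (alpha / (2 - beta)))}.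
  by move=> [s0 _]; exact: powR_continuous.
have kc s (k : R) (f : R -> R) : {for s, continuous f} ->
    {for s, continuous (fun t => k * f t)}.
  by move=> fc; apply: cvgM; [exact: cvg_cst|exact: fc].
have ac e s : D s -> {for s, continuous (fun t => t `^ e)}.
  by move=> [s0 _]; exact: powR_continuous.
have Lc s : D s -> {for s, continuous (fun t => (log_dist r c t)^-1)}.
  by move=> Ds; have [s0 [r0 _]] := Ds; apply: log_dist_inv_continuous => //; exact: DL.
(* By the chain rule [X_k d] is c Gamma^(c-1) [X_k Gamma], and the exponents add up: (alpha - 2) c +
   2 (c - 1) = a - 1. *)
have grad_d x : (Omega `\ y) x ->
    Gamma x `^ ((alpha - 2) / (2 - beta)) * grad_sq X d x =
    c ^+ 2 * Gamma x `^ (a - 1) * grad_sq X Gamma x.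
  move=> [Ox /eqP xy]; have Tx := Omega_sub_T hOmega _ Ox.
  have Gx := G0 x (subset_closure Ox) xy.
  rewrite /grad_sq !mulr_sumr; apply: eq_bigr => k _.
  have /is_XderP[_ ->] := is_Xder_comp _ _ _ _ _ _ (is_derive1_powR c Gx)
    (is_Xder_Gamma hGamma k x Tx xy).
  rewrite (_ : a - 1 = (alpha - 2) / (2 - beta) + ((c - 1) + (c - 1))).
    by rewrite !powRD ?(gt_eqF Gx) ?implybT//; ring.
  by rewrite /a /c; field.
pose P0 (s : R) := c ^+ 2 * s `^ (a - 1).
pose P1 (s : R) := c ^+ 2 * s `^ (a - 1) * log_dist r c s ^- 2.
have P0c s : D s -> {for s, continuous P0} by move=> Ds; apply: kc; exact: ac.
have P1c s : D s -> {for s, continuous P1}.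
  move=> Ds; rewrite (_ : P1 = (fun t =>
      P0 t * ((log_dist r c t)^-1 * (log_dist r c t)^-1))).
    by apply: cvgM; [exact: P0c|apply: cvgM; exact: Lc].
  by apply/funext => t; rewrite /P1 -exprVn expr2.
have P00 s : D s -> 0 <= P0 s by move=> _; rewrite mulr_ge0 ?sqr_ge0 ?powR_ge0.
have P10 s : D s -> 0 <= P1 s.
  by move=> Ds; rewrite mulr_ge0 ?P00// invr_ge0 sqr_ge0.
pose k0 : R := ((beta + alpha - 2) / 2) ^+ 2.
have hardyE : hardy = (\int[nu]_(x in Omega `\ y)
    (k0 * P0 (Gamma x) * grad_sq X Gamma x * u x ^+ 2)%:E)%E.
  rewrite -(integral_densityZ hGamma hOmega u hu D GD k0 P0) ?sqr_ge0//.
  congr (_ * _)%E; apply: eq_integral => x /set_mem Ox.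
  by rewrite grad_d// real_normK ?num_real.
have logE : log_term = (\int[nu]_(x in Omega `\ y)
    (4^-1 * P1 (Gamma x) * grad_sq X Gamma x * u x ^+ 2)%:E)%E.
  rewrite -(integral_densityZ hGamma hOmega u hu D GD 4^-1 P1) ?invr_ge0//.
  congr (_ * _)%E; apply: eq_integral => x /set_mem Ox.
  rewrite grad_d// real_normK ?num_real// /P1 /log_dist /d; congr (_%:E); ring.
have bdry_cont (f : R -> R) : (forall s, D s -> {for s, continuous f}) ->
    cont_on (bdry Omega) (fun x => f (Gamma x) * u x ^+ 2).
  move=> fc; have bc : bdry Omega `<=` closure Omega by move=> x [].
  have uc : cont_on (bdry Omega) u.
    by apply: cont_on_sub bc _; have [_ /cont_onP] := hu.
  apply: cont_onM; last by apply: cont_onM; exact: uc.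
  have AD x : bdry Omega x -> x != y -> T x /\ D (Gamma x).
    by move=> /bc cx xy; split; [exact: (closure_sub_T hOmega)|exact: GD].
  apply: cont_on_sub (Gamma_comp_cont_on hGamma _ D f AD fc) => x bx.
  by split => // xy; apply: hy; rewrite -xy.
have f0c := bdry_cont (fun s => s `^ a) (ac a).
have f1c : cont_on (bdry Omega)
    (fun x => Gamma x `^ a * (log_dist r c (Gamma x))^-1 * u x ^+ 2).
  apply: (bdry_cont (fun s => s `^ a * (log_dist r c s)^-1)) => s Ds.
  by apply: cvgM; [exact: ac|exact: Lc].
have linE p q := flux_grad_lin hGamma hOmega hy p q _ _ f0c f1c.
have hbE : hardy_bdry = - (a / 2) *
    flux w S (fun i x => (Gamma x `^ a * u x ^+ 2) *: grad_field X Gamma i x).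
  rewrite /hardy_bdry; congr (_ * _).
    by rewrite aE /c; field; rewrite kap0 -oppr_eq0 opprB.
  congr flux; apply/funext => i; apply/funext => x.
  by rewrite real_normK ?num_real.
have lbE : log_bdry = - (c / 2) * flux w S (fun i x =>
    (Gamma x `^ a * (log_dist r c (Gamma x))^-1 * u x ^+ 2) *: grad_field X Gamma i x).
  rewrite /log_bdry; congr (_ * _).
    by rewrite /c; field; rewrite kap0 -oppr_eq0 opprB.
  congr flux; apply/funext => i; apply/funext => x.
  by rewrite real_normK ?num_real.
(* The Hardy constant of the statement is thus the optimal a^2/4 of the profile, the factor c^2
   coming from the gradient of [d]. *)
have ka : k0 * c ^+ 2 = a ^+ 2 / 4 by rewrite aE /k0; field.
split.
- have fl : - (a / 2) * flux w S (fun i x =>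
        (Gamma x `^ a * u x ^+ 2) *: grad_field X Gamma i x) =
      flux w S (fun i x =>
        (- (a / 2) * Gamma x `^ a * u x ^+ 2) *: grad_field X Gamma i x).
    have := linE (- (a / 2)) 0; rewrite mul0r addr0 => <-.
    congr flux; apply/funext => i; apply/funext => x.
    by rewrite mul0r addr0 mulrA.
  rewrite hardyE hbE fl.
  apply: (weighted_hardy hGamma hOmega hy u hu D _ GD W0 Wc
    (fun t => - (a / 2) * t `^ a) (fun s => - (a / 2) * (a * s `^ (a - 1)))
    (fun s => k0 * P0 s)) => s Ds.
  + by apply: hardy_profile_derive; case: Ds.
  + by apply: (kc); apply: (kc); exact: ac.
  + by apply: (kc); exact: P0c.
  + by rewrite mulr_ge0 ?powR_ge0// oppr_ge0 pmulr_lle0 ?invr_gt0// ltW.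
  + by rewrite mulr_ge0 ?sqr_ge0 ?P00.
  + rewrite WE (_ : k0 * P0 s = a ^+ 2 / 4 * s `^ (a - 1)); last by rewrite -ka /P0 mulrA.
    by rewrite hardy_profile_eq//; case: Ds.
- rewrite -addeA -EFinD hardyE logE hbE lbE.
  (* Both boundary terms are gathered into one flux, that of the logarithmic profile. *)
  rewrite [- (c / 2) * _ + _]addrC -linE.
  rewrite (integral_densityD hGamma hOmega u hu D GD
    (fun s => k0 * P0 s) (fun s => 4^-1 * P1 s)); last 4 first.
  + by move=> s Ds; apply: (kc); exact: P0c.
  + by move=> s Ds; rewrite mulr_ge0 ?sqr_ge0 ?P00.
  + by move=> s Ds; apply: (kc); exact: P1c.
  + by move=> s Ds; rewrite mulr_ge0 ?invr_ge0 ?P10.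
  pose phi t := - (a / 2) * t `^ a + - (c / 2) * (t `^ a * (log_dist r c t)^-1).
  rewrite (_ : (fun i x => _ *: _) = (fun i x =>
      (phi (Gamma x) * u x ^+ 2) *: grad_field X Gamma i x)); last first.
    by apply/funext => i; apply/funext => x; congr (_ *: _); rewrite /phi; ring.
  apply: (weighted_hardy hGamma hOmega hy u hu D _ GD W0 Wc phi
    (fun t => - (a / 2) * (a * t `^ (a - 1)) + - (c / 2) *
      (t `^ a * (log_dist r c t ^- 2 * (c / t)) +
       (log_dist r c t)^-1 * (a * t `^ (a - 1))))
    (fun s => k0 * P0 s + 4^-1 * P1 s)) => s Ds;
    have L0 := DL s Ds; have [s0 [r0 Lp]] := Ds.
  + exact: log_profile_derive.
  + exact: log_profile_derive_continuous.
  + by apply: cvgD; apply: (kc); [exact: P0c|exact: P1c].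
  + have half0 (k : R) : k < 0 -> 0 <= - (k / 2) by move=> k_lt0; lra.
    apply: addr_ge0; apply: mulr_ge0; rewrite ?half0 ?powR_ge0//.
    by apply: mulr_ge0; [exact: powR_ge0|rewrite invr_ge0; exact: ltW].
  + by apply: addr_ge0; apply: mulr_ge0; rewrite ?sqr_ge0 ?P00 ?P10 ?invr_ge0.
  + rewrite WE (_ : k0 * P0 s + 4^-1 * P1 s =
      (a ^+ 2 / 4 + c ^+ 2 / 4 * log_dist r c s ^- 2) * s `^ (a - 1)).
      by rewrite log_profile_eq.
    by rewrite -ka /P0 /P1; ring.
Qed.
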